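(* Let $\mathcal{A}$ be a Hom-finite Krull-Schmidt $k$-category for which there is a positive integer $n\ge 2$ such that each indecomposable complex in $\mathbf{C}^b(\mathcal{A})$ is a shift of an indecomposable complex in $\mathbf{C}_{[1,n]}(\mathcal{A})$. Assume that $\mathcal{A}$ is a dualizing category such that $\operatorname{mod}\mathcal{A}$ has finite global dimension, and let $m$ be a positive integer. Then $\mathbf{C}_{\equiv m}(\mathcal{A})$ has almost split sequences.
   Context: $k$ is a commutative ring. $\operatorname{Mod}\mathcal{A}$ is the category of contravariant $k$-linear functors $\mathcal{A}\to\operatorname{Mod}k$, and $\operatorname{mod}\mathcal{A}$ is the full subcategory of finitely presented functors. $\mathcal{A}$ is dualizing (Auslander-Reiten) if the finitely presented and the finitely copresented objects of $\operatorname{Mod}\mathcal{A}$ coincide (finitely copresented: kernel of a morphism between functors of the form $D\mathcal{A}(X,-)$, with $D$ the standard duality of $k$-modules); then $\operatorname{mod}\mathcal{A}$ is abelian with enough projectives. $\mathbf{C}^b(\mathcal{A})$ is the category of bounded cochain complexes over $\mathcal{A}$; $\mathbf{C}_{[1,n]}(\mathcal{A})$ is the full subcategory of complexes with $X^i=0$ for $i\notin[1,n]$. $\mathbf{C}_{\equiv m}(\mathcal{A})$ is the category of $m$-periodic complexes: complexes $X=(X^i,d_X^i)_{i\in\mathbb{Z}}$ with $X^i=X^j$, $d_X^i=d_X^j$ whenever $i\equiv j\pmod m$; morphisms are chain maps $(f^i)$ with $f^i=f^j$ whenever $i\equiv j\pmod m$. It is a Frobenius exact category whose conflations are the sequences $X\to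 Y\to Z$ that are split exact in each degree. An almost split sequence is a conflation $X\xrightarrow{f}Y\xrightarrow{g}Z$ with $f$ minimal left almost split and $g$ minimal right almost split. An exact category has almost split sequences if every indecomposable non-projective object is the end term, and every indecomposable non-injective object the starting term, of an almost split sequence. *)

(* Defs.v *)
From HB Require Import structures.
From mathcomp Require Import all_boot all_order all_algebra.
From mathcomp Require Import boolp classical_sets.

Set Implicit Arguments.
Unset Strict Implicit.
Unset Printing Implicit Defensive.

Import Order.TTheory GRing.Theory Num.Theory.

Local Open Scope classical_set_scope.
Local Open Scope ring_scope.

Declare Scope klin_scope.
Delimit Scope klin_scope with klin.

Section LinearMaps.
Variables (k : comPzRingType) (U V : lmodType k).

Definition mklin (f : U -> V) (hf : linear f) : {linear U -> V} :=
  HB.pack f (GRing.isLinear.Build k U V *:%R f hf).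

Lemma lin_ext (f g : {linear U -> V}) : f =1 g -> f = g.
Proof.
case: f g => f [[af1] [af2]] [g [[ag1] [ag2]]] /= /funext fg.
by subst g; rewrite (Prop_irrelevance af1 ag1) (Prop_irrelevance af2 ag2).
Qed.

Lemma lin0_subproof : linear (fun _ : U => 0 : V).
Proof. by move=> a x y; rewrite scaler0 addr0. Qed.
Lemma linD_subproof (f g : {linear U -> V}) : linear (fun x => f x + g x).
Proof. by move=> a x y; rewrite !linearP scalerDr addrACA. Qed.
Lemma linN_subproof (f : {linear U -> V}) : linear (fun x => - f x).
Proof. by move=> a x y; rewrite linearP opprD scalerN. Qed.
Lemma linZ_subproof c (f : {linear U -> V}) : linear (fun x => c *: f x).
Proof. by move=> a x y; rewrite linearP scalerDr !scalerA mulrC. Qed.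

Definition lin0 := mklin lin0_subproof.
Definition linD f g := mklin (linD_subproof f g).
Definition linN f := mklin (linN_subproof f).
Definition linZ c f := mklin (linZ_subproof c f).

HB.instance Definition _ := gen_eqMixin {linear U -> V}.
HB.instance Definition _ := gen_choiceMixin {linear U -> V}.

Lemma linDA : associative linD.
Proof. by move=> f g h; apply: lin_ext => x /=; rewrite addrA. Qed.
Lemma linDC : commutative linD.
Proof. by move=> f g; apply: lin_ext => x /=; rewrite addrC. Qed.
Lemma lin0D : left_id lin0 linD.
Proof. by move=> f; apply: lin_ext => x /=; rewrite add0r. Qed.
Lemma linND : left_inverse lin0 linN linD.
Proof. by move=> f; apply: lin_ext => x /=; rewrite addNr. Qed.

HB.instance Definition _ :=
  GRing.isZmodule.Build {linear U -> V} linDA linDC lin0D linND.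

Lemma linZA a b f : linZ a (linZ b f) = linZ (a * b) f.
Proof. by apply: lin_ext => x /=; rewrite scalerA. Qed.
Lemma lin1Z : left_id 1 linZ.
Proof. by move=> f; apply: lin_ext => x /=; rewrite scale1r. Qed.
Lemma linZDr : right_distributive linZ +%R.
Proof. by move=> a f g; apply: lin_ext => x /=; rewrite scalerDr. Qed.
Lemma linZDl f : {morph linZ^~ f : a b / a + b}.
Proof. by move=> a b; apply: lin_ext => x /=; rewrite scalerDl. Qed.

HB.instance Definition _ :=
  GRing.Zmodule_isLmodule.Build k {linear U -> V} linZA lin1Z linZDr linZDl.

End LinearMaps.

Section Modules.
Variable k : comPzRingType.

Definition submodule (M : lmodType k) (W : set M) : Prop :=
  W 0 /\ forall (c : k) x y, W x -> W y -> W (c *: x + y).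

(** [W1] is contained in [W2] and [W2 / W1] is simple. *)
Definition simple_factor (M : lmodType k) (W1 W2 : set M) : Prop :=
  [/\ submodule W1, submodule W2, W1 `<` W2 &
      forall W, submodule W -> W1 `<=` W -> W `<=` W2 -> W = W1 \/ W = W2].

Definition finite_length (M : lmodType k) : Prop :=
  exists (l : nat) (W : nat -> set M),
    [/\ W 0%N = [set 0], W l = setT &
        forall i, (i < l)%N -> simple_factor (W i) (W i.+1)].

(** Ideals of [k] are the submodules of the regular module [k^o]. *)
Definition maximal_ideal (I : set k^o) : Prop := simple_factor I setT.

Definition generated (M : lmodType k) (S : set M) : set M :=
  [set x | forall W, submodule W -> S `<=` W -> W x].

Definition essential (M : lmodType k) (S : set M) : Prop :=
  forall W : set M, submodule W -> (exists2 x, W x & x <> 0) ->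
    exists x, [/\ W x, S x & x <> 0].

Definition injective_module (E : lmodType k) : Prop :=
  forall (M N : lmodType k) (i : {linear M -> N}) (f : {linear M -> E}),
    injective i -> exists g : {linear N -> E}, forall x, g (i x) = f x.

(** [E] is an injective envelope of the direct sum of the [k / I], with [I]
    ranging over the maximal ideals.  A linear map from that sum to [E] is
    determined by the images [e I] of the classes of [1]; since the [k / I] are
    simple and pairwise non-isomorphic, it is injective as soon as every [e I]
    has annihilator exactly [I].  When [k] is a field this says that [E] is
    one-dimensional, and when [k] is artinian that [E] is an injective
    envelope of [k / rad k]. *)
Definition minimal_injective_cogenerator (E : lmodType k) : Prop :=
  injective_module E /\
  exists e : set k^o -> E,
    (forall I, maximal_ideal I -> [set a : k^o | (a : k) *: e I = 0] = I) /\
    essential (generated [set e I | I in maximal_ideal]).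

End Modules.

Record klincat (k : comPzRingType) := KLinCat {
  ob :> Type;
  hom : ob -> ob -> lmodType k;
  idm : forall X, hom X X;
  comp : forall X Y Z, hom Y Z -> hom X Y -> hom X Z;
  compA : forall X Y Z W (h : hom Z W) (g : hom Y Z) (f : hom X Y),
    comp h (comp g f) = comp (comp h g) f;
  comp1m : forall X Y (f : hom X Y), comp (idm Y) f = f;
  compm1 : forall X Y (f : hom X Y), comp f (idm X) = f;
  compPl : forall X Y Z (f : hom X Y), linear (fun g : hom Y Z => comp g f);
  compPr : forall X Y Z (g : hom Y Z), linear (fun f : hom X Y => comp g f)
}.

Arguments hom {k} {_} X Y.
Arguments idm {k} {_} X.
Arguments comp {k} {_} {X Y Z} g f.
Notation "g ∘ f" := (comp g f)
  (at level 40, left associativity) : klin_scope.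
Local Open Scope klin_scope.

Section CategoryNotions.
Variables (k : comPzRingType) (C : klincat k).

Definition is_zero (X : C) : Prop :=
  (forall Y (f : hom X Y), f = 0) /\ (forall Y (f : hom Y X), f = 0).

Definition is_iso (X Y : C) (f : hom X Y) : Prop :=
  exists g : hom Y X, g ∘ f = idm X /\ f ∘ g = idm Y.

Definition isomorphic (X Y : C) : Prop := exists f : hom X Y, is_iso f.

Definition split_mono (X Y : C) (f : hom X Y) : Prop :=
  exists r : hom Y X, r ∘ f = idm X.

Definition split_epi (X Y : C) (f : hom X Y) : Prop :=
  exists s : hom Y X, f ∘ s = idm Y.

Definition biproduct (X Y S : C) (i1 : hom X S) (i2 : hom Y S)
    (p1 : hom S X) (p2 : hom S Y) : Prop :=
  [/\ p1 ∘ i1 = idm X, p2 ∘ i2 = idm Y, p1 ∘ i2 = 0, p2 ∘ i1 = 0 &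
      i1 ∘ p1 + i2 ∘ p2 = idm S].

Definition is_direct_sum2 (X Y S : C) : Prop :=
  exists (i1 : hom X S) (i2 : hom Y S) (p1 : hom S X) (p2 : hom S Y),
    biproduct i1 i2 p1 p2.

Definition is_direct_sum (n : nat) (Y : 'I_n -> C) (S : C) : Prop :=
  exists (e : forall j, hom (Y j) S) (p : forall j, hom S (Y j)),
    [/\ forall j, p j ∘ e j = idm (Y j),
        forall i j, i != j -> p i ∘ e j = 0 &
        \sum_j (e j ∘ p j) = idm S].

Definition additive_category : Prop :=
  (exists Z : C, is_zero Z) /\
  (forall X Y : C, exists S : C, is_direct_sum2 X Y S).

Definition indecomposable (X : C) : Prop :=
  ~ is_zero X /\
  forall Y Z : C, is_direct_sum2 Y Z X -> is_zero Y \/ is_zero Z.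

(** The endomorphism ring of [X] is local: it is not the zero ring and its
    non-units are closed under addition. *)
Definition local_end (X : C) : Prop :=
  idm X <> 0 /\
  forall f g : hom X X, is_iso (f + g) -> is_iso f \/ is_iso g.

Definition krull_schmidt : Prop :=
  additive_category /\
  forall X : C, exists (n : nat) (Y : 'I_n -> C),
    (forall j, local_end (Y j)) /\ is_direct_sum Y X.

Definition hom_finite : Prop := forall X Y : C, finite_length (hom X Y).

Definition left_almost_split (X Y : C) (f : hom X Y) : Prop :=
  ~ split_mono f /\
  forall (W : C) (h : hom X W), ~ split_mono h ->
    exists h' : hom Y W, h' ∘ f = h.

Definition right_almost_split (Y Z : C) (g : hom Y Z) : Prop :=
  ~ split_epi g /\
  forall (W : C) (h : hom W Z), ~ split_epi h ->
    exists h' : hom W Y, g ∘ h' = h.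

Definition left_minimal (X Y : C) (f : hom X Y) : Prop :=
  forall h : hom Y Y, h ∘ f = f -> is_iso h.

Definition right_minimal (Y Z : C) (g : hom Y Z) : Prop :=
  forall h : hom Y Y, g ∘ h = g -> is_iso h.

Section ExactStructure.
(** The class of conflations of an exact structure on [C]. *)
Variable conf : forall X Y Z : C, hom X Y -> hom Y Z -> Prop.

Definition exact_projective (P : C) : Prop :=
  forall (X Y Z : C) (f : hom X Y) (g : hom Y Z), conf f g ->
    forall h : hom P Z, exists h' : hom P Y, g ∘ h' = h.

Definition exact_injective (I : C) : Prop :=
  forall (X Y Z : C) (f : hom X Y) (g : hom Y Z), conf f g ->
    forall h : hom X I, exists h' : hom Y I, h' ∘ f = h.

Definition almost_split_sequence (X Y Z : C) (f : hom X Y) (g : hom Y Z) :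
    Prop :=
  [/\ conf f g, left_minimal f /\ left_almost_split f &
      right_minimal g /\ right_almost_split g].

Definition has_almost_split_sequences : Prop :=
  (forall Z : C, indecomposable Z -> ~ exact_projective Z ->
    exists (X Y : C) (f : hom X Y) (g : hom Y Z), almost_split_sequence f g) /\
  (forall X : C, indecomposable X -> ~ exact_injective X ->
    exists (Y Z : C) (f : hom X Y) (g : hom Y Z), almost_split_sequence f g).

End ExactStructure.
End CategoryNotions.

Definition full_subcategory (k : comPzRingType) (C : klincat k)
    (P : C -> Prop) : klincat k :=
  @KLinCat k {X : C | P X} (fun X Y => hom (sval X) (sval Y))
    (fun X => idm (sval X)) (fun X Y Z g f => g ∘ f)
    (fun X Y Z W => @compA k C _ _ _ _) (fun X Y => @comp1m k C _ _)
    (fun X Y => @compm1 k C _ _) (fun X Y Z => @compPl k C _ _ _)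
    (fun X Y Z => @compPr k C _ _ _).

(** Complexes over [A] graded by a type [I] with a successor map [s]: cochain
    complexes for [i |-> i + 1] on [int], and [m]-periodic complexes for the
    cyclic successor on [Z/mZ]. *)
Section Complexes.
Variables (I : Type) (s : I -> I) (k : comPzRingType) (A : klincat k).

Record complex := Complex {
  cobj :> I -> A;
  cdiff : forall i, hom (cobj i) (cobj (s i));
  cdiffK : forall i, cdiff (s i) ∘ cdiff i = 0
}.

Section ChainMaps.
Variables X Y : complex.

Record chain_map := ChainMap {
  chain_fun :> forall i, hom (X i) (Y i);
  chain_comm : forall i,
    cdiff Y i ∘ chain_fun i = chain_fun (s i) ∘ cdiff X i
}.

Lemma chain_ext (f g : chain_map) : (forall i, f i = g i) -> f = g.
Proof.
case: f g => f cf [g cg] /= fg.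
have {}fg : f = g by apply: functional_extensionality_dep.
by subst g; rewrite (Prop_irrelevance cf cg).
Qed.

HB.instance Definition _ := gen_eqMixin chain_map.
HB.instance Definition _ := gen_choiceMixin chain_map.

Fact compD0 (U V W : A) (f : hom U V) : (0 : hom V W) ∘ f = 0.
Proof. exact: (linear0 (mklin (@compPl k A U V W f))). Qed.
Fact comp0D (U V W : A) (g : hom V W) : g ∘ (0 : hom U V) = 0.
Proof. exact: (linear0 (mklin (@compPr k A U V W g))). Qed.
Fact compDl (U V W : A) (g h : hom V W) (f : hom U V) :
  (g + h) ∘ f = g ∘ f + h ∘ f.
Proof. exact: (linearD (mklin (@compPl k A U V W f))). Qed.
Fact compDr (U V W : A) (g : hom V W) (f h : hom U V) :
  g ∘ (f + h) = g ∘ f + g ∘ h.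
Proof. exact: (linearD (mklin (@compPr k A U V W g))). Qed.
Fact compNl (U V W : A) (g : hom V W) (f : hom U V) : (- g) ∘ f = - (g ∘ f).
Proof. exact: (linearN (mklin (@compPl k A U V W f))). Qed.
Fact compNr (U V W : A) (g : hom V W) (f : hom U V) : g ∘ (- f) = - (g ∘ f).
Proof. exact: (linearN (mklin (@compPr k A U V W g))). Qed.
Fact compZl (U V W : A) c (g : hom V W) (f : hom U V) :
  (c *: g) ∘ f = c *: (g ∘ f).
Proof. exact: (linearZ_LR (mklin (@compPl k A U V W f))). Qed.
Fact compZr (U V W : A) c (g : hom V W) (f : hom U V) :
  g ∘ (c *: f) = c *: (g ∘ f).
Proof. exact: (linearZ_LR (mklin (@compPr k A U V W g))). Qed.

Program Definition chain0 := @ChainMap (fun=> 0) _.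
Next Obligation. by rewrite compD0 comp0D. Qed.
Program Definition chainD (f g : chain_map) :=
  @ChainMap (fun i => f i + g i) _.
Next Obligation. by rewrite compDr compDl !chain_comm. Qed.
Program Definition chainN (f : chain_map) := @ChainMap (fun i => - f i) _.
Next Obligation. by rewrite compNr compNl chain_comm. Qed.
Program Definition chainZ (c : k) (f : chain_map) :=
  @ChainMap (fun i => c *: f i) _.
Next Obligation. by rewrite compZr compZl chain_comm. Qed.

Lemma chainDA : associative chainD.
Proof. by move=> f g h; apply: chain_ext => i /=; rewrite addrA. Qed.
Lemma chainDC : commutative chainD.
Proof. by move=> f g; apply: chain_ext => i /=; rewrite addrC. Qed.
Lemma chain0D : left_id chain0 chainD.
Proof. by move=> f; apply: chain_ext => i /=; rewrite add0r. Qed.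
Lemma chainND : left_inverse chain0 chainN chainD.
Proof. by move=> f; apply: chain_ext => i /=; rewrite addNr. Qed.

HB.instance Definition _ :=
  GRing.isZmodule.Build chain_map chainDA chainDC chain0D chainND.

Lemma chainZA a b f : chainZ a (chainZ b f) = chainZ (a * b) f.
Proof. by apply: chain_ext => i /=; rewrite scalerA. Qed.
Lemma chain1Z : left_id 1 chainZ.
Proof. by move=> f; apply: chain_ext => i /=; rewrite scale1r. Qed.
Lemma chainZDr : right_distributive chainZ +%R.
Proof. by move=> a f g; apply: chain_ext => i /=; rewrite scalerDr. Qed.
Lemma chainZDl f : {morph chainZ^~ f : a b / a + b}.
Proof. by move=> a b; apply: chain_ext => i /=; rewrite scalerDl. Qed.

HB.instance Definition _ :=
  GRing.Zmodule_isLmodule.Build k chain_map chainZA chain1Z chainZDr chainZDl.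

End ChainMaps.

Program Definition chain_id (X : complex) : chain_map X X :=
  @ChainMap X X (fun i => idm (X i)) _.
Next Obligation. by rewrite compm1 comp1m. Qed.

Program Definition chain_comp (X Y Z : complex) (g : chain_map Y Z)
    (f : chain_map X Y) : chain_map X Z :=
  @ChainMap X Z (fun i => g i ∘ f i) _.
Next Obligation. by rewrite compA chain_comm -compA chain_comm compA. Qed.

Lemma chain_compA (X Y Z W : complex) (h : chain_map Z W) (g : chain_map Y Z)
  (f : chain_map X Y) :
  chain_comp h (chain_comp g f) = chain_comp (chain_comp h g) f.
Proof. by apply: chain_ext => i; exact: compA. Qed.
Lemma chain_comp1m (X Y : complex) (f : chain_map X Y) :
  chain_comp (chain_id Y) f = f.
Proof. by apply: chain_ext => i; exact: comp1m. Qed.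
Lemma chain_compm1 (X Y : complex) (f : chain_map X Y) :
  chain_comp f (chain_id X) = f.
Proof. by apply: chain_ext => i; exact: compm1. Qed.
Lemma chain_compPl (X Y Z : complex) (f : chain_map X Y) :
  linear (fun g : chain_map Y Z => chain_comp g f).
Proof. by move=> c g h; apply: chain_ext => i; exact: compPl. Qed.
Lemma chain_compPr (X Y Z : complex) (g : chain_map Y Z) :
  linear (fun f : chain_map X Y => chain_comp g f).
Proof. by move=> c f h; apply: chain_ext => i; exact: compPr. Qed.

Definition complex_cat : klincat k :=
  @KLinCat k complex (fun X Y => chain_map X Y : lmodType k)
    chain_id chain_comp chain_compA chain_comp1m chain_compm1
    chain_compPl chain_compPr.

(** [X[1]], with [X[1]^i = X^(i+1)] and differential [- d]. *)
Program Definition shift (X : complex) : complex :=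
  @Complex (fun i => X (s i)) (fun i => - cdiff X (s i)) _.
Next Obligation. by rewrite compNl compNr opprK cdiffK. Qed.

(** [X] is isomorphic to [Y[t]] or to [Y[-t]] for some [t >= 0]; the second
    possibility is expressed as [Y] being isomorphic to [X[t]]. *)
Definition is_shift_of (X Y : complex_cat) : Prop :=
  exists t : nat,
    isomorphic X (iter t shift Y : complex_cat) \/
    isomorphic Y (iter t shift X : complex_cat).

Definition degreewise_split (X Y Z : complex_cat) (f : hom X Y) (g : hom Y Z) :
    Prop :=
  forall i : I,
    exists (r : hom (cobj Y i) (cobj X i)) (t : hom (cobj Z i) (cobj Y i)),
      biproduct (f i) t r (g i).

End Complexes.

Section ComplexCategories.
Variables (k : comPzRingType) (A : klincat k).

Definition cochain_cat : klincat k :=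
  complex_cat (fun i : int => i + 1) A.

Definition bounded_cat : klincat k :=
  @full_subcategory k cochain_cat (fun X =>
    exists a b : int, forall i : int, ~~ (a <= i <= b) -> is_zero (cobj X i)).

Definition interval_cat (n : nat) : klincat k :=
  @full_subcategory k cochain_cat (fun X =>
    forall i : int, ~~ (1 <= i <= n%:Z) -> is_zero (cobj X i)).

(** A family over [Z] depending only on the index modulo [m] is a
    family over [Z/mZ], here ['I_m] with the cyclic successor [ordS]. *)
Definition periodic_cat (m : nat) : klincat k := complex_cat (@ordS m) A.

Definition periodic_conflation (m : nat) (X Y Z : periodic_cat m)
    (f : hom X Y) (g : hom Y Z) : Prop := degreewise_split f g.

End ComplexCategories.

Section FunctorCategories.
Variables (k : comPzRingType) (A : klincat k).

Record modA := ModA {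
  mobj :> A -> lmodType k;
  mmap : forall X Y : A, hom X Y -> {linear mobj Y -> mobj X};
  mmap1 : forall X u, mmap (idm X) u = u;
  mmapM : forall (X Y Z : A) (g : hom Y Z) (f : hom X Y) u,
    mmap (g ∘ f) u = mmap f (mmap g u);
  mmapP : forall (X Y : A), linear (@mmap X Y)
}.

Record nat_trans (F G : modA) := NatTrans {
  nt_fun :> forall X : A, {linear F X -> G X};
  nt_nat : forall (X Y : A) (f : hom X Y) u,
    nt_fun X (mmap F f u) = mmap G f (nt_fun Y u)
}.

Lemma hom_map_linear (X Y Z : A) :
  linear (fun f : hom Y Z => mklin (@compPl k A Y Z X f)).
Proof. by move=> c f g; apply: lin_ext => u; exact: compPr. Qed.

Program Definition hom_functor (X : A) : modA :=
  @ModA (fun Y => hom Y X) (fun Y Z f => mklin (@compPl k A Y Z X f))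
    _ _ (hom_map_linear X).
Next Obligation. exact: compm1. Qed.
Next Obligation. exact: compA. Qed.

Lemma dual_map_subproof (E : lmodType k) (X Y Z : A) (f : hom Y Z)
  (phi : {linear hom X Z -> E}) : linear (fun g : hom X Y => phi (f ∘ g)).
Proof. by move=> c g h; rewrite compPr linearP. Qed.

Definition dual_map (E : lmodType k) (X Y Z : A) (f : hom Y Z)
    (phi : {linear hom X Z -> E}) : {linear hom X Y -> E} :=
  mklin (dual_map_subproof f phi).

Lemma dual_map_linear (E : lmodType k) (X Y Z : A) (f : hom Y Z) :
  linear (@dual_map E X Y Z f).
Proof. by move=> c phi psi; apply: lin_ext. Qed.

Lemma dual_map1 (E : lmodType k) (X Y : A) (phi : {linear hom X Y -> E}) :
  dual_map (idm Y) phi = phi.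
Proof. by apply: lin_ext => g /=; rewrite comp1m. Qed.
Lemma dual_mapM (E : lmodType k) (X Y Z W : A) (g : hom Z W) (f : hom Y Z)
  (phi : {linear hom X W -> E}) :
  dual_map (g ∘ f) phi = dual_map f (dual_map g phi).
Proof. by apply: lin_ext => h /=; rewrite compA. Qed.
Lemma dual_mapP (E : lmodType k) (X Y Z : A) :
  linear (fun f : hom Y Z => mklin (@dual_map_linear E X Y Z f)).
Proof.
move=> c f g; apply: lin_ext => phi; apply: lin_ext => h /=.
by rewrite compPl linearP.
Qed.

(** [D A(X,-)] for [D = Hom_k(-, E)]. *)
Definition dual_hom_functor (E : lmodType k) (X : A) : modA :=
  @ModA (fun Y => {linear hom X Y -> E} : lmodType k)
    (fun Y Z f => mklin (@dual_map_linear E X Y Z f))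
    (@dual_map1 E X) (@dual_mapM E X) (@dual_mapP E X).

(** Exactness in [Mod A] is pointwise.  If [A] is dualizing, [mod A] is closed
    under kernels and cokernels in [Mod A], so that the same notion is exactness
    in the abelian category [mod A]. *)
Definition nt_surjective (F G : modA) (a : nat_trans F G) : Prop :=
  forall X v, exists u, a X u = v.

Definition nt_injective (F G : modA) (a : nat_trans F G) : Prop :=
  forall X, injective (a X).

Definition nt_exact (F G H : modA) (a : nat_trans F G) (b : nat_trans G H) :
    Prop :=
  forall X v, b X v = 0 <-> exists u, a X u = v.

Definition finitely_presented (F : modA) : Prop :=
  exists (X Y : A) (a : nat_trans (hom_functor X) (hom_functor Y))
         (b : nat_trans (hom_functor Y) F),
    nt_exact a b /\ nt_surjective b.

Definition finitely_copresented (E : lmodType k) (F : modA) : Prop :=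
  exists (X Y : A) (a : nat_trans F (dual_hom_functor E X))
         (b : nat_trans (dual_hom_functor E X) (dual_hom_functor E Y)),
    nt_injective a /\ nt_exact a b.

Definition dualizing (E : lmodType k) : Prop :=
  forall F : modA, finitely_presented F <-> finitely_copresented E F.

(** Projective objects of [mod A].  As [mod A] is closed under cokernels in
    [Mod A], its epimorphisms are the pointwise surjective morphisms. *)
Definition mod_projective (P : modA) : Prop :=
  finitely_presented P /\
  forall (F G : modA) (g : nat_trans F G) (h : nat_trans P G),
    finitely_presented F -> finitely_presented G -> nt_surjective g ->
    exists h' : nat_trans P F, forall X u, g X (h' X u) = h X u.

Definition pd_le (d : nat) (F : modA) : Prop :=
  exists (P : nat -> modA) (del : forall i, nat_trans (P i.+1) (P i))
         (eps : nat_trans (P 0%N) F),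
    [/\ forall i, mod_projective (P i),
        forall i, (d < i)%N -> forall X (u : P i X), u = 0,
        nt_surjective eps, nt_exact (del 0%N) eps &
        forall i, nt_exact (del i.+1) (del i)].

Definition finite_global_dimension : Prop :=
  exists d : nat, forall F : modA, finitely_presented F -> pd_le d F.

End FunctorCategories.

(* Main.v *)
From HB Require Import structures.
Require Import Defs.
From mathcomp Require Import all_boot all_order all_algebra.
From mathcomp Require Import boolp classical_sets.

(* [hom] has to denote the morphisms of a k-linear category. *)
Import Defs.

Set Implicit Arguments.
Unset Strict Implicit.
Unset Printing Implicit Defensive.

Import Order.TTheory GRing.Theory Num.Theory.

Local Open Scope classical_set_scope.
Local Open Scope ring_scope.
Local Open Scope klin_scope.

(** In the exact category of periodic complexes the projective and the injective
    objects are the contractible complexes, and extensions of [Z] by [X] are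
    classified by homotopy classes of maps [xi : Z -> X[1]].  If [X] and [Z] have
    local endomorphism rings, the extension of a class [xi <> 0] is an almost
    split sequence as soon as [xi ∘ h = 0] for every non-split epimorphism [h]
    to [Z]; the left almost split property and both minimality conditions follow
    from locality ([almost_split_extension]).

    Such a class is a piece of Serre duality.  Write [D] for the duality
    [Hom_k(-, E)] and [Hom_K] for maps up to homotopy.  Suppose that
    [Hom_K(-, X[1])] is isomorphic to [D Hom_K(T, -)].  A functional on the
    endomorphisms of an indecomposable noncontractible summand [Z] of [T] that
    kills the radical but not the identity then corresponds to a nonzero
    [xi : Z -> X[1]] that is killed by all non-split epimorphisms
    ([almost_vanishing_map]).  For a sequence that ends at a given [Z] one takes
    [T = Z] and has to find [X]; for one that starts at a given [X] one has to
    find [T].  Replacing a complex by an indecomposable summand is possible since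
    idempotents split ([splits_exchange]) and, by Fitting's lemma, indecomposable
    complexes have local endomorphism rings.

    Both [X] and [T] are found among complexes of functors on [A].  The trace
    [f |-> sum_i u_i (f_i)] identifies [D Hom_K(T, Y)] with the homotopy classes
    of maps from the complex of representable functors of [Y] to the complex with
    terms [D A(T^i, -)] ([trace_surjective], [trace_injective]), so that the task
    is to compare this complex of functors, up to homotopy as seen by the
    complexes of representables, with a complex of representables.  This is
    dimension shifting ([representable_step]): a contractible complex [L] that
    covers [M], with kernel [N], makes [Hom_K(Y, M)] isomorphic to
    [Hom_K(Y, N[1])].  Since [A] is dualizing of finite global dimension, the
    functors [D A(T, -)] have finite resolutions by representables, and finitely
    many steps lead from them to a complex of representables, which is [X[1]].
    In the other direction the representable functors have finite coresolutions
    by functors [D A(T, -)]: cosyzygies exist because [A] is dualizing, and one of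
    high order splits off by the vanishing of Ext ([cosyzygy_lift]).  The steps
    then end at a complex of functors [D A(T^i, -)], and it comes from a complex
    [T] over [A] because [D] is fully faithful on representables, finite-length
    modules being reflexive with respect to [E] ([reflexive]).

    Periodicity enters only through a finite index set with an injective
    successor, on which sums over all degrees make sense. *)

(** * Modules of finite length and duality with an injective cogenerator *)

Lemma dependent_choice (I : Type) (T : I -> Type) (P : forall i, T i -> Prop) :
  (forall i, exists x, P i x) -> exists f, forall i, P i (f i).
Proof. by move=> h; exists (fun i => sval (cid (h i))) => i; case: cid. Qed.

Section Submodules.
Variable k : comPzRingType.
Implicit Types M N : lmodType k.

Lemma submD M (W : set M) x y : submodule W -> W x -> W y -> W (x + y).
Proof. by move=> [_ hW] hx hy; rewrite -[x]scale1r; apply: hW. Qed.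

Lemma submZ M (W : set M) c x : submodule W -> W x -> W (c *: x).
Proof. by move=> [h0 hW] hx; rewrite -[_ *: _]addr0; apply: hW. Qed.

Lemma submN M (W : set M) x : submodule W -> W x -> W (- x).
Proof. by move=> hW hx; rewrite -scaleN1r; apply: submZ. Qed.

Lemma submB M (W : set M) x y : submodule W -> W x -> W y -> W (x - y).
Proof. by move=> hW hx hy; apply: submD => //; apply: submN. Qed.

Definition adjoin M (W : set M) (y : M) : set M :=
  [set x | exists c, W (x - c *: y)].

Lemma submodule_adjoin M (W : set M) y : submodule W -> submodule (adjoin W y).
Proof.
move=> hW; split; first by exists 0; rewrite scale0r subr0; exact: hW.1.
move=> c x z [a ha] [b hb]; exists (c * a + b).
have -> : c *: x + z - (c * a + b) *: y = c *: (x - a *: y) + (z - b *: y).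
  by rewrite scalerDl scalerBr scalerA opprD addrACA.
exact: hW.2.
Qed.

Lemma sub_adjoin M (W : set M) y : submodule W -> W `<=` adjoin W y.
Proof. by move=> hW x hx; exists 0; rewrite scale0r subr0. Qed.

Lemma mem_adjoin M (W : set M) y : submodule W -> adjoin W y y.
Proof. by move=> hW; exists 1; rewrite scale1r subrr; exact: hW.1. Qed.

Lemma proper_adjoin M (W : set M) y : submodule W -> ~ W y -> W `<` adjoin W y.
Proof.
move=> hW hy; split; first exact: sub_adjoin.
by move=> /(_ y (mem_adjoin y hW)).
Qed.

(** The chain conditions in the form in which they are used: one bounded
    function certifies the ascending and the descending one, and it is inherited
    along injections, so that no composition series has to be constructed. *)
Definition ranked M : Prop :=
  exists (rk : set M -> nat) (l : nat), forall V W, submodule V ->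
    submodule W -> V `<` W -> (rk V < rk W <= l)%N.

(** The rank of a submodule counts the steps of a composition series of [M] in
    which the submodule meets the step outside of the previous term. *)
Lemma finite_length_ranked M : finite_length M -> ranked M.
Proof.
move=> [l [W [W0 Wl hs]]].
pose meets V i := `[< exists y, [/\ V y, W i.+1 y & ~ W i y] >].
exists (fun V => \sum_(i < l) meets V i)%N, l => V V' hV hV' [sVV' nV'V].
apply/andP; split; last first.
  rewrite -[X in (_ <= X)%N]card_ord -sum1_card; apply: leq_sum => i _.
  exact: leq_b1.
have le i : (meets V i <= meets V' i)%N.
  suff: meets V i -> meets V' i by case: (meets V i); case: (meets V' i) => // ->.
  move=> /asboolP[y [hy h1 h2]]; apply/asboolP; exists y; split => //.
  exact: sVV'.
rewrite ltnNge; apply/negP => ge; apply: nV'V.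
have eq_meets i : (i < l)%N -> meets V' i -> meets V i.
  move=> hi m'; apply/negPn/negP => m; move: ge; apply/negP; rewrite -ltnNge.
  rewrite (bigD1 (Ordinal hi)) //= [X in (_ < X)%N](bigD1 (Ordinal hi)) //=.
  rewrite m' (negPf m) add0n add1n ltnS; apply: leq_sum => j _; exact: le.
suff main i : (i <= l)%N -> V' `&` W i `<=` V.
  by move=> x hx; apply: (main l (leqnn l)); split => //; rewrite Wl.
elim: i => [_|i IH hi] x [hx hWx].
  by move: hWx; rewrite W0 => ->; exact: hV.1.
have [hWi|nWi] := pselect (W i x); first by apply: (IH (ltnW hi)).
have [sW sW' pW smp] := hs _ hi.
have /asboolP[y [hy Wy nWy]] : meets V i.
  by apply: eq_meets => //; apply/asboolP; exists x.
have sub : adjoin (W i) y `<=` W i.+1.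
  move=> z [c hc]; rewrite -[z](subrK (c *: y)).
  by apply: submD => //; [apply: pW.1|apply: submZ].
have [e|e] := smp _ (submodule_adjoin y sW) (sub_adjoin y sW) sub.
  by have := mem_adjoin y sW; rewrite e.
have [c hc] : adjoin (W i) y x by rewrite e.
rewrite -[x](subrK (c *: y)); apply: submD => //; last exact: submZ.
apply: (IH (ltnW hi)); split => //.
by apply: submB => //; apply: submZ => //; apply: sVV'.
Qed.

Lemma ranked_inj M N (f : {linear M -> N}) : injective f -> ranked N -> ranked M.
Proof.
move=> fI [rk [l h]]; exists (fun V => rk (f @` V)), l => V W hV hW [s ns].
have im U : submodule U -> submodule (f @` U).
  move=> hU; split; first by exists 0; [exact: hU.1|rewrite linear0].
  move=> c _ _ [x hx <-] [y hy <-]; exists (c *: x + y); last by rewrite linearP.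
  exact: hU.2.
apply: h; [exact: im|exact: im|split; first exact: image_subset].
move=> s'; apply: ns => x hx.
by have [|y hy /fI <-] := s' (f x); first by exists x.
Qed.

Lemma ranked_stable M (W : nat -> set M) : ranked M ->
  (forall i, submodule (W i)) -> (forall i, W i.+1 `<=` W i) ->
  exists i, W i `<=` W i.+1.
Proof.
move=> [rk [l h]] hW dec.
have [n le_n] := ubnP (rk (W 0%N)).
have : exists i, (rk (W i) < n)%N by exists 0%N.
elim: n {le_n} => [[//]|n IH [i hi]].
have [s|ns] := pselect (W i `<=` W i.+1); first by exists i.
apply: IH; exists i.+1.
have /andP[lt _] := h _ _ (hW i.+1) (hW i) (conj (@dec i) ns).
by apply: leq_trans lt _; rewrite -ltnS.
Qed.

(** The hypothesis says that [x] generates a simple module modulo [W], and a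
    simple cyclic module is [k] modulo a maximal ideal. *)
Lemma maximal_annihilator M (W : set M) x : submodule W -> ~ W x ->
  (forall b : k, ~ W (b *: x) -> adjoin W (b *: x) x) ->
  maximal_ideal [set a : k^o | W ((a : k) *: x)].
Proof.
move=> hW nWx h; set I := [set a : k^o | _].
have hI : submodule I.
  split; first by rewrite /I /= scale0r; exact: hW.1.
  move=> c a b ha hb; rewrite /I /= scalerDl -scalerA; exact: hW.2.
split => //.
  by split => // /(_ 1 Logic.I); rewrite /I /= scale1r.
move=> J hJ sIJ _.
have [sJI|nJI] := pselect (J `<=` I); first by left; apply/seteqP.
right; apply/seteqP; split => // a _.
have [b [Jb nIb]] : exists b, J b /\ ~ I b.
  apply: contrapT => nex; apply: nJI => b Jb; apply: contrapT => nIb.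
  by apply: nex; exists b.
have [c hc] := h _ nIb.
have J1 : J 1.
  rewrite -[1 : k^o](subrK ((c * b : k) : k^o)); apply: submD => //.
    by apply: sIJ; rewrite /I /= scalerBl scale1r -scalerA.
  exact: (submZ c hJ Jb).
by have := submZ a hJ J1; rewrite /GRing.scale /= mulr1.
Qed.

(** Enlarging [W] to a submodule maximal among those that avoid [x]: the
    annihilator of [x] modulo the enlarged submodule is a maximal ideal. *)
Lemma maximal_avoiding M (W : set M) x : ranked M -> submodule W -> ~ W x ->
  exists W', [/\ submodule W', W `<=` W', ~ W' x &
    maximal_ideal [set a : k^o | W' ((a : k) *: x)]].
Proof.
move=> [rk [l h]] hW nWx.
suff [W' [h1 h2 h3 h4]] : exists W', [/\ submodule W', W `<=` W', ~ W' x &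
    forall V, submodule V -> W' `<` V -> V x].
  exists W'; split => //; apply: maximal_annihilator => // b nb.
  by apply: h4; [exact: submodule_adjoin|exact: proper_adjoin].
have [n le_n] := ubnP (l - rk W)%N.
elim: n W hW nWx le_n => // n IH W hW nWx le_n.
have [mx|nmx] := pselect (forall V, submodule V -> W `<` V -> V x).
  by exists W; split.
have [V [hV lt nVx]] : exists V, [/\ submodule V, W `<` V & ~ V x].
  apply: contrapT => nex; apply: nmx => V hV lt; apply: contrapT => nVx.
  by apply: nex; exists V.
have /andP[r1 r2] := h _ _ hW hV lt.
have [|W' [a1 a2 a3 a4]] := IH V hV nVx.
  rewrite ltnS in le_n; apply: leq_trans le_n; apply: ltn_sub2l => //.
  exact: leq_trans r1 r2.
by exists W'; split => //; apply: subset_trans a2; exact: lt.1.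
Qed.

End Submodules.

Section SubmoduleType.
Variables (k : comPzRingType) (M : lmodType k) (W : set M).
Hypothesis hW : submodule W.

Definition submod_type : Type := (fun _ : submodule W => {x : M | W x}) hW.

Lemma submod_inj (x y : submod_type) : sval x = sval y -> x = y.
Proof.
case: x y => [x hx] [y hy] /= e; subst y.
by rewrite (Prop_irrelevance hx hy).
Qed.

HB.instance Definition _ := gen_eqMixin submod_type.
HB.instance Definition _ := gen_choiceMixin submod_type.

Definition sm0 : submod_type := exist _ 0 hW.1.
Definition smD (x y : submod_type) : submod_type :=
  exist _ (sval x + sval y) (submD hW (svalP x) (svalP y)).
Definition smN (x : submod_type) : submod_type :=
  exist _ (- sval x) (submN hW (svalP x)).
Definition smZ c (x : submod_type) : submod_type :=
  exist _ (c *: sval x) (submZ c hW (svalP x)).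

Lemma smDA : associative smD.
Proof. by move=> x y z; apply: submod_inj; apply: addrA. Qed.
Lemma smDC : commutative smD.
Proof. by move=> x y; apply: submod_inj; apply: addrC. Qed.
Lemma sm0D : left_id sm0 smD.
Proof. by move=> x; apply: submod_inj; apply: add0r. Qed.
Lemma smND : left_inverse sm0 smN smD.
Proof. by move=> x; apply: submod_inj; apply: addNr. Qed.
HB.instance Definition _ :=
  GRing.isZmodule.Build submod_type smDA smDC sm0D smND.
Lemma smZA a b x : smZ a (smZ b x) = smZ (a * b) x.
Proof. by apply: submod_inj; apply: scalerA. Qed.
Lemma sm1Z : left_id 1 smZ.
Proof. by move=> x; apply: submod_inj; apply: scale1r. Qed.
Lemma smZDr : right_distributive smZ +%R.
Proof. by move=> a x y; apply: submod_inj; apply: scalerDr. Qed.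
Lemma smZDl x : {morph smZ^~ x : a b / a + b}.
Proof. by move=> a b; apply: submod_inj; apply: scalerDl. Qed.
HB.instance Definition _ :=
  GRing.Zmodule_isLmodule.Build k submod_type smZA sm1Z smZDr smZDl.

Definition submod : lmodType k := submod_type.
Definition submod_val : {linear submod -> M} :=
  mklin (f := fun x : submod => sval x : M) (fun a x y => erefl).

Lemma submod_val_inj : injective submod_val.
Proof. exact: submod_inj. Qed.

End SubmoduleType.

Section InjectiveCogenerator.
Variables (k : comPzRingType) (E : lmodType k).
Hypothesis E_inj : injective_module E.

(** Injectivity in the form of an extension along the image of [a], which spares
    quotient modules. *)
Lemma extend_along (M N : lmodType k) (a : {linear M -> N})
  (phi : {linear M -> E}) : (forall x, a x = 0 -> phi x = 0) ->
  exists psi : {linear N -> E}, forall x, psi (a x) = phi x.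
Proof.
move=> ker.
have hW : submodule (range a).
  split; first by exists 0; rewrite ?linear0.
  by move=> c _ _ [x _ <-] [y _ <-]; exists (c *: x + y); rewrite ?linearP.
have [pre preP] : exists pre : submod hW -> M, forall y, a (pre y) = sval y.
  apply: (@dependent_choice _ _ (fun (y : submod hW) x => a x = sval y)).
  by move=> [y [x hx ex]]; exists x.
have phiE x y : a x = sval y -> phi (pre y) = phi x.
  move=> e; apply/eqP; rewrite -subr_eq0 -linearB; apply/eqP/ker.
  by rewrite linearB /= preP e subrr.
have lin : linear (fun y : submod hW => phi (pre y)).
  move=> c y z; rewrite -linearP; apply: phiE.
  by rewrite linearP /= !preP.
have [psi psiP] := E_inj (mklin lin) (@submod_val_inj _ _ _ hW).
exists psi => x.
have hx : range a (a x) by exists x.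
have /= := psiP (exist _ (a x) hx : submod hW); rewrite /submod_val /= => ->.
exact: phiE.
Qed.

Hypothesis E_cogen : minimal_injective_cogenerator E.

(** [e I] is the image in [E] of the class of [1] in [k / I]. *)
Let e : set k^o -> E := sval (cid E_cogen.2).
Let eP := svalP (cid E_cogen.2).

Lemma annE (I : set k^o) (a : k) : maximal_ideal I -> a *: e I = 0 <-> I a.
Proof. by move=> hI; have := eP.1 I hI; rewrite -/e => {2}<-. Qed.

(** On [W + k x] the functional is forced: [w + a x] goes to [a e_I]. *)
Lemma functional_at (M : lmodType k) (W : set M) x : submodule W ->
  maximal_ideal [set a : k^o | W ((a : k) *: x)] ->
  exists phi : {linear M -> E}, (forall w, W w -> phi w = 0) /\
    phi x = e [set a : k^o | W ((a : k) *: x)].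
Proof.
move=> hW; set I := [set a | _] => hI.
pose al (p : submod hW * k^o) : M := sval p.1 + (p.2 : k) *: x.
have al_lin : linear al.
  move=> c [w a] [w' a'] /=; rewrite /al /= scalerDl scalerDr scalerA.
  by rewrite addrACA.
pose ph (p : submod hW * k^o) : E := (p.2 : k) *: e I.
have ph_lin : linear ph.
  by move=> c [w a] [w' a'] /=; rewrite /ph /= scalerDl scalerA.
have [|psi psiP] := @extend_along _ _ (mklin al_lin) (mklin ph_lin).
  move=> [[w hw] a] /=; rewrite /al /ph /= => e0; apply/annE => //.
  rewrite /I /=; have -> : a *: x = - w.
    by apply/eqP; rewrite -addr_eq0 addrC e0.
  exact: submN.
exists psi; split.
  move=> w hw; have /= := psiP (exist _ w hw : submod hW, 0).
  by rewrite /al /ph /= !scale0r addr0.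
by have /= := psiP (0, 1); rewrite /al /ph /= !scale1r add0r.
Qed.

(** After enlarging [W] to a submodule maximal among those that avoid [x], the
    class of [x] spans a copy of some [k / I], which embeds into [E]. *)
Lemma cogenerate (M : lmodType k) (W : set M) x : ranked M -> submodule W ->
  ~ W x -> exists phi : {linear M -> E},
    (forall w, W w -> phi w = 0) /\ phi x <> 0.
Proof.
move=> rM hW nWx.
have [W' [hW' sWW' nW'x mx]] := maximal_avoiding rM hW nWx.
have [phi [p0 px]] := functional_at hW' mx.
exists phi; split => [w /sWW'|]; first exact: p0.
rewrite px -[e _]scale1r => /(annE 1 mx); rewrite /= scale1r.
exact: nW'x.
Qed.

Lemma comaximal (I J : set k^o) : maximal_ideal I -> maximal_ideal J ->
  J <> I -> exists2 a : k^o, J a & I (1 - a).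
Proof.
move=> [hI _ [_ pI] smI] [hJ _ [_ pJ] smJ] neq.
have [b [Jb nIb]] : exists b, J b /\ ~ I b.
  apply: contrapT => nex.
  have sJI : J `<=` I.
    by move=> b Jb; apply: contrapT => nIb; apply: nex; exists b.
  have [e1|e1] := smJ _ hI sJI (@subsetT _ _); first exact: neq.
  by apply: pI; rewrite e1.
have := smI _ (submodule_adjoin b hI) (sub_adjoin b hI) (@subsetT _ _).
move=> [eI|eT]; first by case: nIb; rewrite -eI; exact: mem_adjoin.
have [c hc] : adjoin I b 1 by rewrite eT.
by exists (c *: b) => //; apply: submZ.
Qed.

(** The elements of [E] killed by [I] form the simple module [k / I]: they lie
    in the socle of [E], whose components at other maximal ideals are killed by
    an element congruent to [1] modulo [I]. *)
Lemma socle_torsion (I : set k^o) z : maximal_ideal I ->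
  (forall a : k, I a -> a *: z = 0) -> exists c, z = c *: e I.
Proof.
move=> mI tors; have [hI _ [_ pI] smI] := mI.
have [->|nz] := pselect (z = 0); first by exists 0; rewrite scale0r.
have hz : submodule [set y | exists c, y = c *: z].
  split; first by exists 0; rewrite scale0r.
  move=> c _ _ [a ->] [b ->]; exists (c * a + b).
  by rewrite scalerDl scalerA.
have [|y [[c ->] gen ncz]] := eP.2 _ hz.
  by exists z => //; exists 1; rewrite scale1r.
have nIc : ~ I c by move=> /tors.
have [b Ib] : exists b : k, I (1 - b * c).
  have := smI _ (submodule_adjoin (c : k^o) hI) (sub_adjoin (c : k^o) hI) (@subsetT _ _).
  move=> [eI|eT]; first by case: nIc; rewrite -eI; exact: mem_adjoin.
  have [b hb] : adjoin I (c : k^o) 1 by rewrite eT.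
  by exists b.
(* The elements whose component at [I] is cut out by an element of [1 + I]; this
   submodule contains every [e J], hence the socle. *)
pose W := [set y : E | exists a : k, I (1 - a) /\ exists d, a *: y = d *: e I].
have hW : submodule W.
  split; first by exists 1; rewrite subrr; split; [exact: hI.1|]; exists 0;
    rewrite scaler0 scale0r.
  move=> t y1 y2 [a1 [h1 [d1 e1]]] [a2 [h2 [d2 e2]]].
  exists (a1 * a2); split.
    have -> : (1 - a1 * a2 : k^o) = a1 *: (1 - a2 : k^o) + (1 - a1 : k^o).
      by rewrite /GRing.scale /= mulrBr mulr1 [RHS]addrC addrA subrK.
    exact: hI.2.
  exists (a2 * t * d1 + a1 * d2); rewrite scalerDr.
  rewrite scalerDl -!scalerA -e1 -e2 !scalerA.
  by rewrite [a1 * a2]mulrC mulrAC.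
have [a [Ia [d ed]]] : W (c *: z).
  apply: gen => // _ [J mJ <-].
  have [->|neq] := pselect (J = I).
    by exists 1; rewrite subrr; split; [exact: hI.1|exists 1].
  have [a Ja Ia] := comaximal mI mJ neq.
  by exists a; split => //; exists 0; rewrite scale0r; apply/annE.
exists (b * d).
have ez t : I (1 - t) -> t *: z = z.
  by move=> /tors; rewrite scalerBl scale1r => /eqP; rewrite subr_eq0 => /eqP.
by rewrite -scalerA -ed !scalerA mulrCA -scalerA !ez //.
Qed.

(** Finite-length modules are reflexive: a functional on the dual is peeled off
    along a composition series, each simple factor [k / I] contributing an
    evaluation because its dual is again [k / I]. *)
Lemma reflexive (M : lmodType k) (Phi : {linear {linear M -> E} -> E}) :
  finite_length M -> exists x, forall f, Phi f = f x.
Proof.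
move=> [l [W [W0 Wl hs]]].
(* The larger [i], the fewer functionals [f] the hypothesis on [Psi] concerns. *)
suff main i : (i <= l)%N -> forall Psi : {linear {linear M -> E} -> E},
    (forall f : {linear M -> E}, (forall w, W i w -> f w = 0) -> Psi f = 0) ->
    exists x, forall f, Psi f = f x.
  apply: (main l (leqnn l)) => f f0; suff -> : f = 0 by rewrite linear0.
  by apply: lin_ext => x; apply: f0; rewrite Wl.
elim: i => [_|i IH hi] Psi hPsi.
  exists 0 => f; rewrite linear0; apply: hPsi => w; rewrite W0 => ->.
  exact: linear0.
have [sW sW' [sub nsub] smp] := hs _ hi.
have [y [Wy nWy]] : exists y, W i.+1 y /\ ~ W i y.
  apply: contrapT => nex; apply: nsub => x hx; apply: contrapT => nx.
  by apply: nex; exists x.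
have full x : W i.+1 x -> ~ W i x -> adjoin (W i) x = W i.+1.
  move=> hx nx.
  have s : adjoin (W i) x `<=` W i.+1.
    move=> z [c hc]; rewrite -[z](subrK (c *: x)).
    by apply: submD => //; [apply: sub|apply: submZ].
  have [e1|//] := smp _ (submodule_adjoin x sW) (sub_adjoin x sW) s.
  by case: nx; rewrite -e1; exact: mem_adjoin.
have mI := maximal_annihilator sW nWy (fun b nb =>
  eq_ind_r (fun S => S y) Wy (full _ (submZ b sW' Wy) nb)).
set I := [set a : k^o | _] in mI.
have [g [g0 gy]] := functional_at sW mI; rewrite -/I in gy.
have vanish (f : {linear M -> E}) : (forall w, W i w -> f w = 0) -> f y = 0 ->
    Psi f = 0.
  move=> f0 fy; apply: hPsi => w; rewrite -(full _ Wy nWy) => -[c hc].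
  by rewrite -[w](subrK (c *: y)) linearD f0 // linearZ /= fy scaler0 addr0.
have [b gb] : exists b, Psi g = b *: e I.
  apply: socle_torsion => // a Ia; rewrite -linearZ; apply: vanish.
    by move=> w hw /=; rewrite g0 ?scaler0.
  by rewrite /= gy; apply/annE.
have ev_lin : linear (fun f : {linear M -> E} => Psi f - f (b *: y)).
  move=> c f f'; rewrite linearP /= opprD addrACA scalerBr; congr (_ + _).
have [|x hx] := IH (ltnW hi) (mklin ev_lin).
  move=> f f0 /=.
  have [c fc] : exists c, f y = c *: e I.
    by apply: socle_torsion => // a Ia; rewrite -linearZ /=; apply: f0.
  have : Psi (f - c *: g) = 0.
    apply: vanish => [w hw|] /=; first by rewrite f0 // g0 // scaler0 subrr.
    by rewrite fc gy subrr.
  rewrite linearB linearZ /= gb => /eqP; rewrite subr_eq0 => /eqP ->.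
  have -> : f (b *: y) = b *: (c *: e I) by rewrite linearZ /= fc.
  by rewrite !scalerA mulrC subrr.
exists (x + b *: y) => f; rewrite linearD -hx /= subrK //.
Qed.

End InjectiveCogenerator.

(** * Idempotents, local rings and summands in a k-linear category *)

Section Idempotents.
Variables (k : comPzRingType) (C : klincat k).
Implicit Types X Y Z R S : C.

Lemma compBl X Y Z (g h : hom Y Z) (f : hom X Y) :
  (g - h) ∘ f = g ∘ f - h ∘ f.
Proof. by rewrite compDl compNl. Qed.
Lemma compBr X Y Z (g : hom Y Z) (f h : hom X Y) :
  g ∘ (f - h) = g ∘ f - g ∘ h.
Proof. by rewrite compDr compNr. Qed.

Lemma comp_suml X Y Z (I : finType) (F : I -> hom Y Z) (f : hom X Y) :
  (\sum_i F i) ∘ f = \sum_i (F i ∘ f).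
Proof. exact: (linear_sum (mklin (@compPl k C X Y Z f))). Qed.
Lemma comp_sumr X Y Z (I : finType) (F : I -> hom X Y) (g : hom Y Z) :
  g ∘ (\sum_i F i) = \sum_i (g ∘ F i).
Proof. exact: (linear_sum (mklin (@compPr k C X Y Z g))). Qed.

Definition cbi := (compBl, compBr, compDl, compDr, compNl, compNr, comp1m,
  compm1, compD0, comp0D).

Lemma compKr X Y Z (g : hom Y Z) (f : hom X Y) u :
  g ∘ f = u -> forall W (h : hom Z W), h ∘ g ∘ f = h ∘ u.
Proof. by move=> <- W h; rewrite compA. Qed.

Lemma compKr4 X Y Z V U (g : hom Y Z) (f : hom X Y) (f' : hom V X)
    (f'' : hom U V) u : g ∘ f ∘ f' ∘ f'' = u ->
  forall W (h : hom Z W), h ∘ g ∘ f ∘ f' ∘ f'' = h ∘ u.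
Proof. by move=> <- W h; rewrite !compA. Qed.

Lemma zero_of_id X : idm X = 0 -> is_zero X.
Proof.
by move=> e; split=> Y f; [rewrite -[f]compm1|rewrite -[f]comp1m];
  rewrite e ?compD0 ?comp0D.
Qed.

Lemma iso_comp X Y Z (g : hom Y Z) (f : hom X Y) :
  is_iso g -> is_iso f -> is_iso (g ∘ f).
Proof.
move=> [g' [h1 h2]] [f' [h3 h4]]; exists (f' ∘ g'); split.
  by rewrite compA (compKr h1) compm1.
by rewrite compA (compKr h4) compm1.
Qed.

Definition splits X (e : hom X X) : Prop :=
  exists R (i : hom R X) (p : hom X R), p ∘ i = idm R /\ i ∘ p = e.

Definition idempotent_complete : Prop :=
  forall X (e : hom X X), e ∘ e = e -> splits e.

Lemma splits_transfer X Y (a : hom Y X) (b : hom X Y) (e : hom Y Y) :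
  b ∘ a = idm Y -> splits e -> splits (a ∘ e ∘ b).
Proof.
move=> ba [R [i [p [pi <-]]]]; exists R, (a ∘ i), (p ∘ b).
by rewrite !compA (compKr ba) compm1 pi.
Qed.

Lemma splits_add X (e f : hom X X) : additive_category C -> e ∘ f = 0 ->
  f ∘ e = 0 -> splits e -> splits f -> splits (e + f).
Proof.
move=> [_ sum2] ef fe [R [i [p [pi ip]]]] [R' [i' [p' [pi' ip']]]].
have [S [j1 [j2 [q1 [q2 [h1 h2 h3 h4 h5]]]]]] := sum2 R R'.
have pi0 : p ∘ i' = 0.
  have : p ∘ (e ∘ f) ∘ i' = p ∘ i'.
    by rewrite -ip -ip' !compA pi comp1m (compKr pi') compm1.
  by rewrite ef comp0D compD0.
have pi0' : p' ∘ i = 0.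
  have : p' ∘ (f ∘ e) ∘ i = p' ∘ i.
    by rewrite -ip -ip' !compA pi' comp1m (compKr pi) compm1.
  by rewrite fe comp0D compD0.
exists S, (i ∘ q1 + i' ∘ q2), (j1 ∘ p + j2 ∘ p'); split.
  rewrite !cbi !compA (compKr pi) (compKr pi') (compKr pi0).
  by rewrite (compKr pi0') !cbi addr0 add0r.
rewrite !cbi !compA (compKr h1) (compKr h2) (compKr h3).
by rewrite (compKr h4) !cbi addr0 add0r ip ip'.
Qed.

(** Exchange: if [e] restricts to an isomorphism on the summand [Y] of [X],
    then [Y] is a summand of the image of [e], and the complementary part of
    [e] lives on the complement [X'] of [Y]. *)
Lemma splits_exchange Y X' X (i : hom Y X) (i1 : hom X' X) (p : hom X Y)
    (p1 : hom X X') (e : hom X X) :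
  additive_category C -> biproduct i i1 p p1 -> e ∘ e = e ->
  is_iso (p ∘ e ∘ i) ->
  (forall e' : hom X' X', e' ∘ e' = e' -> splits e' /\ splits (idm X' - e')) ->
  splits e /\ splits (idm X - e).
Proof.
move=> add [pi pi1 p_i1 p1_i ip] ee [v [vu uv]] IH.
have uv' : p ∘ e ∘ i ∘ v = idm Y by [].
have vu' : v ∘ p ∘ e ∘ i = idm Y by rewrite -vu !compA.
(* Both [f] and [g] project onto the image of [e ∘ i]; the first commutes with
   [e], the second has the complement [X'] of [Y] as its kernel. *)
pose f := e ∘ i ∘ v ∘ p ∘ e; pose g := e ∘ i ∘ v ∘ p.
have ef : e ∘ f = f by rewrite /f !compA ee.
have fe : f ∘ e = f by rewrite /f (compKr ee).
have ff : f ∘ f = f by rewrite /f !compA (compKr ee) (compKr4 uv') compm1.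
have fg : f ∘ g = g by rewrite /f /g !compA (compKr ee) (compKr4 uv') compm1.
have gf : g ∘ f = f by rewrite /f /g !compA (compKr4 uv') compm1.
have pg : p ∘ g = p by rewrite /g !compA uv' comp1m.
have gi1 : g ∘ i1 = 0 by rewrite /g (compKr p_i1) comp0D.
pose a := (idm X - f) ∘ i1; pose b := p1 ∘ (idm X - g).
have ba : b ∘ a = idm X'.
  rewrite /a /b compA -(compA p1).
  have -> : (idm X - g) ∘ (idm X - f) = idm X - g.
    by rewrite !cbi gf opprB addrA subrK.
  by rewrite -compA compBl gi1 comp1m subr0 pi1.
have ab : a ∘ b = idm X - f.
  have i1p1 : i1 ∘ p1 = idm X - i ∘ p by rewrite -ip addrAC subrr add0r.
  rewrite /a /b compA -(compA _ i1) i1p1 -(compA (idm X - f)).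
  have -> : (idm X - i ∘ p) ∘ (idm X - g) = idm X - g.
    by rewrite !cbi -(compA i p) pg subrr subr0.
  by rewrite !cbi fg opprB addrA subrK.
clearbody a b.
pose e' := b ∘ (e - f) ∘ a.
have e'e' : e' ∘ e' = e'.
  rewrite /e' !compA (compKr ab); congr (_ ∘ a).
  rewrite -!compA; congr (b ∘ _).
  by rewrite !cbi ee ef fe ff ?ff !subrr !subr0.
have ae'b : a ∘ e' ∘ b = e - f.
  rewrite /e' !compA ab (compKr ab).
  by rewrite !cbi !ef !fe !ff ?ff !subrr !subr0.
have [s1 s2] := IH _ e'e'; split; last first.
  have -> : idm X - e = a ∘ (idm X' - e') ∘ b.
    by rewrite compBr compBl compm1 ab ae'b opprB addrA subrK.
  exact: splits_transfer.
have -> : e = f + (e - f) by rewrite addrC subrK.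
apply: splits_add => //.
- by rewrite !cbi fe ff subrr.
- by rewrite !cbi ef ff subrr.
- exists Y, (e ∘ i), (v ∘ p ∘ e); split; last by rewrite /f !compA.
  by rewrite !compA (compKr ee) vu'.
by rewrite -ae'b; apply: splits_transfer.
Qed.

End Idempotents.
(** Dependent case analysis on [ord0] and [lift ord0], stated as an existence so
    that no cast appears in the families that it yields. *)
Lemma ord_family n (T : 'I_n.+1 -> Type) (a : T ord0)
    (b : forall j : 'I_n, T (lift ord0 j)) :
  exists f : forall j, T j, f ord0 = a /\ forall j, f (lift ord0 j) = b j.
Proof.
have /(@dependent_choice _ T)[f hf] : forall j, exists x : T j,
    (forall e : ord0 = j, x = eq_rect _ T a _ e) /\
    (forall i (e : lift ord0 i = j), x = eq_rect _ T (b i) _ e).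
  move=> j; case: (unliftP ord0 j) => [i|] ->.
    exists (b i); split=> [e|i' e]; first by case/eqP: (neq_lift ord0 i).
    by move: (e); have -> := lift_inj e => e'; rewrite eq_axiomK.
  exists a; split=> [e|i e]; first by rewrite eq_axiomK.
  by case/eqP: (neq_lift ord0 i).
exists f; split; first by have [-> //] := hf ord0.
by move=> j; have [_ ->] := hf (lift ord0 j).
Qed.

Section KrullSchmidt.
Variables (k : comPzRingType) (C : klincat k).
Hypothesis add : additive_category C.
Implicit Types X Y Z R S : C.

Lemma direct_sum_cons n (Y : 'I_n.+1 -> C) X X'
    (i : hom (Y ord0) X) (i1 : hom X' X) p p1
    (e : forall j, hom (Y (lift ord0 j)) X') q :
  biproduct i i1 p p1 ->
  (forall j, q j ∘ e j = idm _) -> (forall a b, a != b -> q a ∘ e b = 0) ->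
  \sum_j (e j ∘ q j) = idm X' ->
  exists (e' : forall j, hom (Y j) X) (q' : forall j, hom X (Y j)),
    [/\ forall j, q' j ∘ e' j = idm (Y j),
        forall i j, i != j -> q' i ∘ e' j = 0 &
        \sum_j (e' j ∘ q' j) = idm X].
Proof.
move=> [h1 h2 h3 h4 h5] qe qe0 eq.
have [e' [e0 es]] := @ord_family n (fun j => hom (Y j) X) i (fun j => i1 ∘ e j).
have [q' [q0 qs]] := @ord_family n (fun j => hom X (Y j)) p (fun j => q j ∘ p1).
exists e', q'; split.
- move=> j; case: (unliftP ord0 j) => [j'|] ->; last by rewrite e0 q0.
  by rewrite es qs compA (compKr h2) compm1 qe.
- move=> a b.
  case: (unliftP ord0 a) => [a'|] ->; case: (unliftP ord0 b) => [b'|] -> ab.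
  + by rewrite es qs compA (compKr h2) compm1 qe0.
  + by rewrite e0 qs -compA h4 comp0D.
  + by rewrite es q0 compA h3 compD0.
  + by rewrite eqxx in ab.
rewrite big_ord_recl e0 q0 -h5; congr (_ + _).
rewrite -[i1 in RHS]compm1 -eq comp_sumr comp_suml; apply: eq_bigr => j _.
by rewrite es qs !compA.
Qed.

Lemma direct_sum_exists n (Y : 'I_n -> C) : exists S, is_direct_sum Y S.
Proof.
elim: n Y => [|n IH] Y.
  have [[Z [Z1 Z2]] _] := add.
  have e (j : 'I_0) : hom (Y j) Z by case: j.
  have p (j : 'I_0) : hom Z (Y j) by case: j.
  exists Z, e, p; split; [by case|by case|].
  by rewrite big_ord0 [RHS]Z1.
have [X' [e [q [h1 h2 h3]]]] := IH (fun j => Y (lift ord0 j)).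
have [X [i [i1 [p [p1 h]]]]] := add.2 (Y ord0) X'.
by exists X; apply: direct_sum_cons h h1 h2 h3.
Qed.

Lemma direct_sum_uncons n (Y : 'I_n.+1 -> C) X : is_direct_sum Y X ->
  exists X' (i : hom (Y ord0) X) (i1 : hom X' X) p p1,
    biproduct i i1 p p1 /\ is_direct_sum (fun j => Y (lift ord0 j)) X'.
Proof.
move=> [e [p [pe pe0 ep]]].
have [X' [e' [p' [pe' pe0' ep']]]] :=
  direct_sum_exists (fun j => Y (lift ord0 j)).
exists X', (e ord0), (\sum_j (e (lift ord0 j) ∘ p' j)), (p ord0),
  (\sum_j (e' j ∘ p (lift ord0 j))); split; last by exists e', p'.
split.
- exact: pe.
- rewrite comp_suml -ep'; apply: eq_bigr => j _; rewrite comp_sumr.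
  rewrite (bigD1 j) //= !compA (compKr (pe _)) compm1 big1 ?addr0 // => i ij.
  rewrite !compA (compKr (pe0 _ _ _)) ?comp0D ?compD0 //.
  by rewrite (inj_eq lift_inj) eq_sym.
- by rewrite comp_sumr big1 // => j _; rewrite compA pe0 ?compD0.
- rewrite comp_suml big1 // => j _.
  by rewrite -compA pe0 ?comp0D.
rewrite -ep big_ord_recl; congr (_ + _).
rewrite comp_suml; apply: eq_bigr => j _; rewrite comp_sumr.
rewrite (bigD1 j) //= !compA (compKr (pe' _)) compm1 big1 ?addr0 // => i ij.
by rewrite !compA (compKr (pe0' _ _ _)) ?comp0D ?compD0 // eq_sym.
Qed.

(** Induction on the number of local summands.  The first one is a summand of
    the image of [e] or of [idm X - e], since one of the two restricts to an
    isomorphism on it; both conclusions are proved together because of this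
    symmetry. *)
Lemma splits_local_sum n X (Y : 'I_n -> C) : (forall j, local_end (Y j)) ->
  is_direct_sum Y X -> forall e : hom X X, e ∘ e = e ->
  splits e /\ splits (idm X - e).
Proof.
elim: n X Y => [|n IH] X Y loc.
  move=> [? [? [_ _]]]; rewrite big_ord0 => id0 e _.
  have [h1 h2] := zero_of_id (esym id0).
  have s (f : hom X X) : splits f.
    by exists X, (idm X), (idm X); rewrite compm1 [RHS]h1 [idm X]h1.
  by [].
move=> ds e ee.
have [X' [i [i1 [p [p1 [bi ds']]]]]] := direct_sum_uncons ds.
have IH' := IH _ _ (fun j => loc (lift ord0 j)) ds'.
have pi : p ∘ i = idm _ by case: bi.
have [|iso|iso] := (loc ord0).2 (p ∘ e ∘ i) (p ∘ (idm X - e) ∘ i).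
- rewrite -compDl -compDr [e + _]addrC subrK compm1 pi.
  by exists (idm _); rewrite compm1.
- exact: splits_exchange add bi ee iso IH'.
have ee' : (idm X - e) ∘ (idm X - e) = idm X - e.
  by rewrite !cbi ee subrr subr0.
have [s1 s2] := splits_exchange add bi ee' iso IH'.
by split=> //; rewrite -[e](subKr (idm X)).
Qed.

End KrullSchmidt.

Lemma krull_schmidt_idempotent_complete (k : comPzRingType) (C : klincat k) :
  krull_schmidt C -> idempotent_complete C.
Proof.
move=> [add ks] X e ee; have [n [Y [loc ds]]] := ks X.
by have [] := splits_local_sum add loc ds ee.
Qed.

Section Fitting.
Variables (k : comPzRingType) (C : klincat k).
Hypothesis idc : idempotent_complete C.
Hypothesis rk : forall X : C, ranked (hom X X).
Implicit Types X Y Z R S : C.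

Definition fpow X (f : hom X X) n : hom X X := iter n (comp f) (idm X).

Lemma fpowD X (f : hom X X) m n : fpow f (m + n) = fpow f m ∘ fpow f n.
Proof.
elim: m => [|m IH]; first by rewrite /fpow /= comp1m.
by rewrite /fpow addSn !iterS -compA; congr (_ ∘ _); exact: IH.
Qed.

Lemma fpowS X (f : hom X X) n : fpow f n.+1 = f ∘ fpow f n.
Proof. by []. Qed.

Lemma fpowSr X (f : hom X X) n : fpow f n.+1 = fpow f n ∘ f.
Proof. by rewrite -addn1 fpowD /fpow /= compm1. Qed.

(** The chain of the right ideals generated by the powers of [f] stabilizes;
    [fpow_left] is the same for left ideals. *)
Lemma fpow_right X (f : hom X X) : exists n, forall N, (n <= N)%N ->
  exists g, fpow f N = fpow f (N + N) ∘ g.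
Proof.
pose W n : set (hom X X) := [set h | exists g : hom X X, h = fpow f n ∘ g].
have hW n : submodule (W n).
  split; first by exists 0; rewrite comp0D.
  by move=> c _ _ [g ->] [g' ->]; exists (c *: g + g'); rewrite compDr compZr.
have [n sn] : exists n, W n `<=` W n.+1.
  apply: ranked_stable => // n _ [g ->].
  by exists (f ∘ g); rewrite fpowSr compA.
have [g fg] : W n.+1 (fpow f n) by apply: sn; exists (idm X); rewrite compm1.
exists n => N leN.
have step j : exists h, fpow f N = fpow f (N + j) ∘ h.
  elim: j => [|j [h IH]]; first by exists (idm X); rewrite compm1 addn0.
  exists (g ∘ h); rewrite compA {1}IH; congr (_ ∘ h).
  have leNj : (n <= N + j)%N by apply: leq_trans leN (leq_addr _ _).
  by rewrite addnS -(subnK leNj) -addnS !fpowD -compA -fg.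
exact: step.
Qed.

Lemma fpow_left X (f : hom X X) : exists n, forall N, (n <= N)%N ->
  exists g, fpow f N = g ∘ fpow f (N + N).
Proof.
pose W n : set (hom X X) := [set h | exists g : hom X X, h = g ∘ fpow f n].
have hW n : submodule (W n).
  split; first by exists 0; rewrite compD0.
  by move=> c _ _ [g ->] [g' ->]; exists (c *: g + g'); rewrite compDl compZl.
have [n sn] : exists n, W n `<=` W n.+1.
  apply: ranked_stable => // n _ [g ->].
  by exists (g ∘ f); rewrite fpowS compA.
have [g fg] : W n.+1 (fpow f n) by apply: sn; exists (idm X); rewrite comp1m.
exists n => N leN.
have step j : exists h, fpow f N = h ∘ fpow f (N + j).
  elim: j => [|j [h IH]]; first by exists (idm X); rewrite comp1m addn0.
  exists (h ∘ g); rewrite -compA {1}IH; congr (h ∘ _).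
  have leNj : (n <= N + j)%N by apply: leq_trans leN (leq_addr _ _).
  by rewrite addnS -(subnKC leNj) -addSn !fpowD compA -fg.
exact: step.
Qed.

Lemma geometric X (f : hom X X) n : exists g, g ∘ (idm X - f) = idm X - fpow f n
  /\ (idm X - f) ∘ g = idm X - fpow f n.
Proof.
elim: n => [|n [g [h1 h2]]].
  by exists 0; rewrite compD0 comp0D /fpow /= subrr.
exists (g + fpow f n).
rewrite compDl [(_ - f) ∘ (_ + _)]compDr h1 h2 compBl compBr comp1m compm1.
by rewrite -fpowS -fpowSr addrA subrK.
Qed.

(** Fitting: a high power [a] of [f] factors as [a ∘ a ∘ g] and [g' ∘ a ∘ a],
    which makes [a ∘ g] idempotent; if it is [1], [f] is invertible, and if it
    is [0], [f] is nilpotent. *)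
Lemma fitting X (f : hom X X) :
  (forall e : hom X X, e ∘ e = e -> e = 0 \/ e = idm X) ->
  is_iso f \/ is_iso (idm X - f).
Proof.
move=> idem.
have [n hn] := fpow_right f; have [n' hn'] := fpow_left f.
have [g ag] := hn (n' + n).+1 (leqW (leq_addl n' n)).
have [g' ag'] := hn' (n' + n).+1 (leqW (leq_addr n n')).
move: ag ag'; set N := (n' + n)%N; rewrite fpowD => ag ag'.
have abs (a : hom X X) : a = a ∘ a ∘ g -> a = g' ∘ (a ∘ a) ->
    g' ∘ a = a ∘ g /\ (a ∘ g) ∘ (a ∘ g) = a ∘ g.
  move=> h; rewrite compA => h'.
  have e : g' ∘ a = a ∘ g by rewrite {1}h !compA -h'.
  by split=> //; rewrite -{1}e !compA -h'.
have [gaag ee] := abs _ ag ag'; set a := fpow f N.+1 in ag ag' gaag ee *.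
have [e0|e1] := idem _ ee.
  right; have [h [h1 h2]] := geometric f N.+1.
  have a0 : a = 0 by rewrite ag -compA e0 comp0D.
  by exists h; rewrite h1 h2 -/a a0 subr0.
left; have a1 : g' ∘ a = idm X by rewrite gaag.
exists (g' ∘ fpow f N); split.
  by rewrite -compA -fpowSr.
rewrite /a fpowS -compA in e1.
have -> : g' ∘ fpow f N = fpow f N ∘ g.
  by rewrite -[g' ∘ _]compm1 -e1 !compA -[g' ∘ _ ∘ _]compA -fpowSr a1 comp1m.
exact: e1.
Qed.

Lemma indecomposable_idempotent X (e : hom X X) : indecomposable X ->
  e ∘ e = e -> e = 0 \/ e = idm X.
Proof.
move=> [_ ind] ee.
have ee' : (idm X - e) ∘ (idm X - e) = idm X - e.
  by rewrite !cbi ee subrr subr0.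
have [R [i [p [pi ip]]]] := idc ee; have [R' [i' [p' [pi' ip']]]] := idc ee'.
have [] : is_zero R \/ is_zero R'; last 2 first.
- by move=> [_ z]; left; rewrite -ip (z _ p) comp0D.
- move=> [_ z]; right; apply/esym/eqP; rewrite -subr_eq0 -ip' (z _ p') comp0D.
  by rewrite eqxx.
apply: ind; exists i, i', p, p'; split=> //; last by rewrite ip ip' addrC subrK.
- have : p ∘ (e ∘ (idm X - e)) ∘ i' = p ∘ i'.
    by rewrite -ip' -{1}ip !compA pi comp1m (compKr pi') compm1.
  have -> : e ∘ (idm X - e) = 0 by rewrite !cbi ee subrr.
  by rewrite comp0D compD0.
have : p' ∘ ((idm X - e) ∘ e) ∘ i = p' ∘ i.
  by rewrite -ip' -{1}ip !compA pi' comp1m (compKr pi) compm1.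
have -> : (idm X - e) ∘ e = 0 by rewrite !cbi ee subrr.
by rewrite comp0D compD0.
Qed.

Lemma indecomposable_local X : indecomposable X -> local_end X.
Proof.
move=> ind; split; first by move=> /zero_of_id; exact: ind.1.
move=> f g [u [uf fu]].
have lift (h : hom X X) : is_iso (u ∘ h) -> is_iso h.
  move=> iso; have -> : h = (f + g) ∘ (u ∘ h) by rewrite compA fu comp1m.
  by apply: iso_comp => //; exists u.
have [iso|iso] := fitting (u ∘ f) (fun e => indecomposable_idempotent ind).
  by left; apply: lift.
right; apply: lift; move: iso; rewrite -uf compDr addrAC subrr add0r; exact.
Qed.

(** Among the idempotents with the property [P], one with a smallest right ideal
    cannot be decomposed further.  This extracts from [X] an indecomposable
    summand on which a given class does not vanish, without decomposing [X]
    completely. *)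
Lemma local_summand X (P : hom X X -> Prop) : P (idm X) -> ~ P 0 ->
  (forall e f, P (e + f) -> P e \/ P f) ->
  exists R (i : hom R X) (p : hom X R),
    [/\ local_end R, p ∘ i = idm R & P (i ∘ p)].
Proof.
move=> P1 P0 PD; have [r [l hr]] := rk X.
pose W (e : hom X X) : set (hom X X) := [set h | e ∘ h = h].
have hW e : submodule (W e).
  split; first by rewrite /W /= comp0D.
  by move=> c f g; rewrite /W /= compDr compZr => -> ->.
have [e [ee Pe mine]] : exists e : hom X X, [/\ e ∘ e = e, P e &
    forall f, f ∘ f = f -> P f -> ~ W f `<` W e].
  have [n] := ubnP (r (W (idm X))).
  have id1 : idm X ∘ idm X = idm X by rewrite comp1m.
  move: (idm X) id1 P1 => e; elim: n e => // n IH e ee Pe le_n.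
  have [mn|nmn] := pselect (forall f, f ∘ f = f -> P f -> ~ W f `<` W e).
    by exists e.
  have [f [ff Pf lt]] : exists f, [/\ f ∘ f = f, P f & W f `<` W e].
    apply: contrapT => nex; apply: nmn => f ff Pf lt.
    by apply: nex; exists f.
  apply: (IH f) => //; have /andP[r1 _] := hr _ _ (hW f) (hW e) lt.
  exact: leq_trans r1 _.
have [R [i [p [pi ip]]]] := idc ee.
exists R, i, p; split=> //; last by rewrite ip.
apply: indecomposable_local; split.
  by move=> [z _]; apply: P0; rewrite -ip (z _ i) compD0 in Pe.
have key Y Z (j1 : hom Y R) (j2 : hom Z R) q1 q2 :
    biproduct j1 j2 q1 q2 -> P (i ∘ (j1 ∘ q1) ∘ p) -> is_zero Z.
  move=> [h1 h2 h3 h4 h5] Pe1; set e1 := i ∘ (j1 ∘ q1) ∘ p in Pe1.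
  have e1e1 : e1 ∘ e1 = e1.
    by rewrite /e1 !compA (compKr pi) compm1 (compKr h1) compm1.
  have ee1 : e ∘ e1 = e1 by rewrite -ip /e1 !compA (compKr pi) compm1.
  have sub : W e `<=` W e1.
    apply: contrapT => ns; apply: (mine e1) => //; split=> // h hh.
    by rewrite /W /= -hh compA ee1.
  have e1e : e1 ∘ e = e by apply: sub.
  apply: zero_of_id.
  have : q2 ∘ (p ∘ (e1 ∘ e) ∘ i) ∘ j2 = idm Z.
    by rewrite e1e -ip !compA !(compKr pi, compm1) h2.
  by rewrite /e1 -ip !compA !(compKr pi, compm1) h4 !compD0 => <-.
move=> Y Z [j1 [j2 [q1 [q2 bi]]]].
have [] : P (i ∘ (j1 ∘ q1) ∘ p) \/ P (i ∘ (j2 ∘ q2) ∘ p).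
- apply: PD; rewrite -compDl -compDr; case: bi => _ _ _ _ ->.
  by rewrite compm1 ip.
- by move=> Pe1; right; apply: key bi Pe1.
move=> Pe2; left; apply: (key _ _ j2 j1 q2 q1) => //.
by case: bi => h1 h2 h3 h4 h5; split=> //; rewrite addrC.
Qed.

End Fitting.

(** * Homotopies and extensions of complexes *)

Section Successor.
Variables (I : finType) (s : I -> I).
Hypothesis s_inj : injective s.

Lemma all_succ (P : I -> Prop) : (forall i, P (s i)) -> forall j, P j.
Proof.
by move=> h j; have /codomP[i ->] := injF_onto s_inj j.
Qed.

(** A family indexed by the successors is a family: this replaces transport
    along the inverse of [s], which would require casts. *)
Lemma reindex_succ (T : I -> Type) (f : forall i, T (s i)) :
  exists g : forall j, T j, forall i, g (s i) = f i.
Proof.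
have /(@dependent_choice _ T)[g hg] : forall j, exists x : T j,
    forall i (e : s i = j), x = eq_rect _ T (f i) _ e.
  apply: all_succ => i; exists (f i) => i' e; move: (e).
  by have -> := s_inj e => e'; rewrite eq_axiomK.
by exists g => i; rewrite (hg _ i (erefl _)).
Qed.

End Successor.

Section Homotopy.
Variables (I : finType) (s : I -> I) (k : comPzRingType) (A : klincat k).
Hypothesis s_inj : injective s.
Local Notation K := (complex_cat s A).
Implicit Types W X Y Z : K.

Let dd X i : cdiff X (s i) ∘ cdiff X i = 0 := cdiffK X i.

Definition null X Y (f : hom X Y) : Prop :=
  exists h : forall i, hom (cobj X (s i)) (cobj Y i), forall i,
    f (s i) = cdiff Y i ∘ h i + h (s i) ∘ cdiff X (s i).

Lemma null_submodule X Y : submodule [set f : hom X Y | null f].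
Proof.
split.
  by exists (fun=> 0) => i; rewrite compD0 comp0D addr0.
move=> c f g [h hf] [h' hg]; exists (fun i => c *: h i + h' i) => i /=.
by rewrite compDr compDl compZr compZl addrACA -scalerDr -hf -hg.
Qed.

Lemma null_compl X Y Z (g : hom Y Z) (f : hom X Y) : null f -> null (g ∘ f).
Proof.
move=> [h hf]; exists (fun i => g i ∘ h i) => i /=.
by rewrite hf compDr !compA -chain_comm.
Qed.

Lemma null_compr X Y Z (g : hom Y Z) (f : hom X Y) : null g -> null (g ∘ f).
Proof.
move=> [h hg]; exists (fun i => h i ∘ f (s i)) => i /=.
by rewrite hg compDl -!compA -chain_comm.
Qed.

Definition shift_map X Y (f : hom X Y) :
    hom (shift X : K) (shift Y : K) :=
  @ChainMap _ _ _ _ (shift X) (shift Y) (fun i => f (s i))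
    (fun i => etrans (compNl _ _) (etrans (congr1 -%R (chain_comm f (s i)))
      (esym (compNr _ _)))).

Lemma shift_mapM X Y Z (g : hom Y Z) (f : hom X Y) :
  shift_map (g ∘ f) = shift_map g ∘ shift_map f.
Proof. exact: chain_ext. Qed.

Lemma shift_mapD X Y (f g : hom X Y) :
  shift_map (f + g) = shift_map f + shift_map g.
Proof. exact: chain_ext. Qed.

Lemma shift_map1 X : shift_map (idm X) = idm (shift X : K).
Proof. exact: chain_ext. Qed.

(** Classes of extensions are maps into a shift, while a representing complex is
    found without one. *)
Lemma unshift X : exists Y, X = shift Y.
Proof.
case: X => X d d2.
have [X0 eX] : exists X0 : I -> A, X = fun i => X0 (s i).
  have [X0 h] := reindex_succ s_inj (T := fun=> ob A) X.
  by exists X0; apply: funext => i; rewrite h.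
subst X.
have [d' hd'] := reindex_succ s_inj
  (T := fun j => hom (X0 j) (X0 (s j))) (fun i => - d i).
have dd' : forall j, d' (s j) ∘ d' j = 0.
  by apply: (all_succ s_inj) => i; rewrite !hd' compNl compNr opprK d2.
exists (Complex dd'); rewrite /shift /=.
have {hd'} e : d = fun i => - d' (s i).
  by apply: functional_extensionality_dep => i; rewrite hd' opprK.
subst d; congr Complex; exact: Prop_irrelevance.
Qed.

(** For maps into a shift the homotopies can be indexed by all degrees of [Z]
    rather than by successors, as the entries of a change of splitting. *)
Lemma null_shift Z X (xi : hom Z (shift X : K)) : null xi <->
  exists h : forall j, hom (cobj Z j) (cobj X j), forall j,
    xi j = h (s j) ∘ cdiff Z j - cdiff X j ∘ h j.
Proof.
split=> [[h hx]|[h hx]]; last first.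
  by exists (fun i => h (s i)) => i; rewrite hx /= compNl addrC.
have [h' hh'] := reindex_succ s_inj
  (T := fun j => hom (cobj Z j) (cobj X j)) h.
exists h'; apply: (all_succ s_inj) => i.
by rewrite hx !hh' /= compNl addrC.
Qed.

Lemma contractible_shift X : null (idm (shift X : K)) -> null (idm X).
Proof.
move=> [h hX]; have [h' hh'] := reindex_succ s_inj
  (T := fun j => hom (cobj X (s j)) (cobj X j)) (fun i => - h i).
exists h'; apply: (all_succ s_inj) => i; rewrite !hh' compNl compNr.
by have /= -> := hX i; rewrite compNl compNr.
Qed.

(** Used to correct a lift that is only a graded map: a contraction turns it
    into a chain map with the same composite. *)
Lemma htpy_map X Y (h : forall i, hom (cobj X (s i)) (cobj Y i)) :
  exists f : hom X Y, forall i,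
    f (s i) = cdiff Y i ∘ h i + h (s i) ∘ cdiff X (s i).
Proof.
have [v hv] := reindex_succ s_inj (T := fun j => hom (cobj X j) (cobj Y j))
  (fun i => cdiff Y i ∘ h i + h (s i) ∘ cdiff X (s i)).
have hc j : cdiff Y j ∘ v j = v (s j) ∘ cdiff X j.
  move: j; apply: (all_succ s_inj) => i; rewrite !hv !cbi !compA dd.
  by rewrite (compKr (dd X (s i))) !cbi add0r addr0.
by exists (ChainMap hc).
Qed.

Lemma contractible_projective X : null (idm X) ->
  exact_projective (@degreewise_split I s k A) X.
Proof.
move=> [c hc] Y1 Y2 Y3 f g fg h.
have {}hc i : idm (cobj X (s i)) = cdiff X i ∘ c i + c (s i) ∘ cdiff X (s i).
  exact: hc.
have [r /(@dependent_choice _ _)[t hft]] := dependent_choice fg.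
have gt i : g i ∘ t i = idm _ by case: (hft i).
have [v hv] := htpy_map (fun i => t i ∘ h i ∘ c i).
exists v; apply: chain_ext; apply: (all_succ s_inj) => i /=.
rewrite hv compDr !compA -chain_comm (compKr (gt _)) gt !cbi.
by rewrite chain_comm -!compA -compDr -hc compm1.
Qed.

Lemma contractible_injective X : null (idm X) ->
  exact_injective (@degreewise_split I s k A) X.
Proof.
move=> [c hc] Y1 Y2 Y3 f g fg h.
have {}hc i : idm (cobj X (s i)) = cdiff X i ∘ c i + c (s i) ∘ cdiff X (s i).
  exact: hc.
have [r /(@dependent_choice _ _)[t hft]] := dependent_choice fg.
have rf i : r i ∘ f i = idm _ by case: (hft i).
have [v hv] := htpy_map (fun i => c i ∘ (h (s i) ∘ r (s i))).
exists v; apply: chain_ext; apply: (all_succ s_inj) => i /=.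
rewrite hv compDl -!compA chain_comm !compA !(compKr (rf _)) !cbi.
by rewrite -(compA (c (s i))) -(chain_comm h) !compA -compDl -hc comp1m.
Qed.

(** The componentwise inverses automatically commute with the differentials. *)
Lemma iso_components X Y (f : hom X Y) : (forall i, is_iso (f i)) -> is_iso f.
Proof.
move=> /(@dependent_choice _ _)[g hg].
have gf i : g i ∘ f i = idm _ by case: (hg i).
have fg i : f i ∘ g i = idm _ by case: (hg i).
have gc i : cdiff X i ∘ g i = g (s i) ∘ cdiff Y i.
  rewrite -[LHS]comp1m -(gf (s i)) -!compA (compA (f (s i))) -(chain_comm f).
  by rewrite -!compA fg compm1.
by exists (ChainMap gc); split; apply: chain_ext => i /=.
Qed.

(** The extension of [Z] by [X] with class [xi]: the graded direct sum, with
    [xi] as the off-diagonal entry of the differential. *)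
Definition extension Z X (xi : hom Z (shift X : K)) Y (f : hom X Y)
    (g : hom Y Z) (t : forall i, hom (cobj Z i) (cobj Y i))
    (r : forall i, hom (cobj Y i) (cobj X i)) : Prop :=
  (forall i, biproduct (f i) (t i) (r i) (g i)) /\
  (forall i, cdiff Y i ∘ t i = f (s i) ∘ xi i + t (s i) ∘ cdiff Z i).

Lemma extension_exists Z X (xi : hom Z (shift X : K)) :
  additive_category A -> exists Y f g t r, @extension Z X xi Y f g t r.
Proof.
move=> [_ sum2].
have /(@dependent_choice _ _)[S hS] := fun i => sum2 (cobj X i) (cobj Z i).
have [f /(@dependent_choice _ _)[t /(@dependent_choice _ _)[r
  /(@dependent_choice _ _)[g bi]]]] := dependent_choice hS.
have rf i : r i ∘ f i = idm _ by case: (bi i).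
have gt i : g i ∘ t i = idm _ by case: (bi i).
have rt i : r i ∘ t i = 0 by case: (bi i).
have gf i : g i ∘ f i = 0 by case: (bi i).
pose d i := f (s i) ∘ cdiff X i ∘ r i + f (s i) ∘ xi i ∘ g i
  + t (s i) ∘ cdiff Z i ∘ g i.
have df i : d i ∘ f i = f (s i) ∘ cdiff X i.
  by rewrite /d !compDl (compKr (rf i)) !(compKr (gf i)) !cbi !addr0.
have dt i : d i ∘ t i = f (s i) ∘ xi i + t (s i) ∘ cdiff Z i.
  by rewrite /d !compDl (compKr (rt i)) !(compKr (gt i)) !cbi add0r.
have gd i : g (s i) ∘ d i = cdiff Z i ∘ g i.
  by rewrite /d !compDr !compA gf gt !cbi !add0r.
have d2 i : d (s i) ∘ d i = 0.
  rewrite {2}/d !compDr !compA df dt !cbi.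
  rewrite (compKr (dd X i)) (compKr (dd Z i)) !cbi add0r addr0.
  by rewrite -(compA _ _ (cdiff Z i)) -(chain_comm xi) /= !cbi !compA subrr.
pose Y : K := Complex d2.
exists Y, (ChainMap (X := X) (Y := Y) df),
  (ChainMap (X := Y) (Y := Z) (fun i => esym (gd i))), t, r.
by split.
Qed.

Section Extension.
Variables (Z X Y : K) (xi : hom Z (shift X : K)) (f : hom X Y) (g : hom Y Z).
Variables (t : forall i, hom (cobj Z i) (cobj Y i)).
Variables (r : forall i, hom (cobj Y i) (cobj X i)).
Hypothesis ext : extension xi f g t r.

Let rf i : r i ∘ f i = idm _. Proof. by case: (ext.1 i). Qed.
Let gt i : g i ∘ t i = idm _. Proof. by case: (ext.1 i). Qed.
Let rt i : r i ∘ t i = 0. Proof. by case: (ext.1 i). Qed.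
Let gf i : g i ∘ f i = 0. Proof. by case: (ext.1 i). Qed.
Let fr i : f i ∘ r i + t i ∘ g i = idm _. Proof. by case: (ext.1 i). Qed.
Let dt := ext.2.

Let rd i : r (s i) ∘ cdiff Y i = cdiff X i ∘ r i + xi i ∘ g i.
Proof.
rewrite -[cdiff Y i]compm1 -fr !compDr !compA.
rewrite (compKr (chain_comm f i)) (compKr (dt i)) compDr !compA rf rt.
by rewrite !cbi addr0.
Qed.

Lemma extension_conflation : degreewise_split f g.
Proof. by move=> i; exists (r i), (t i); exact: ext.1. Qed.

Lemma extension_lift W (h : hom W Z) :
  null (xi ∘ h) <-> exists h' : hom W Y, g ∘ h' = h.
Proof.
split=> [/(null_shift (xi ∘ h))[u hu]|[h' <-]]; last first.
  apply/null_shift; exists (fun i => r i ∘ h' i) => i /=.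
  by rewrite compA addrC -(compA (r _)) -(chain_comm h') !compA rd compDl addKr.
have hc i : cdiff Y i ∘ (f i ∘ u i + t i ∘ h i) =
    (f (s i) ∘ u (s i) + t (s i) ∘ h (s i)) ∘ cdiff W i.
  rewrite !compDr !compDl !compA dt (chain_comm f) compDl.
  rewrite -!compA -(chain_comm h) addrA !compA; congr (_ + _).
  by rewrite -!compA -compDr; have /= -> := hu i; rewrite addrC subrK.
exists (ChainMap hc); apply: chain_ext => i /=.
by rewrite compDr !compA gf gt !cbi add0r.
Qed.

Lemma extension_extend W (h : hom X W) :
  null (shift_map h ∘ xi) <-> exists h' : hom Y W, h' ∘ f = h.
Proof.
split=> [/(null_shift (shift_map h ∘ xi))[u hu]|[h' <-]]; last first.
  apply/null_shift; exists (fun i => - (h' i ∘ t i)) => i /=.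
  rewrite compNr compNl opprK addrC compA (chain_comm h').
  by rewrite -(compA _ (cdiff Y i)) dt !cbi !compA addrK.
have hc i : cdiff W i ∘ (h i ∘ r i - u i ∘ g i) =
    (h (s i) ∘ r (s i) - u (s i) ∘ g (s i)) ∘ cdiff Y i.
  rewrite compBr compBl -!compA -(chain_comm g) rd !compA (chain_comm h).
  rewrite compDr !compA -addrA; congr (_ + _).
  by have /= -> := hu i; rewrite compBl addrAC subrr add0r.
exists (ChainMap hc); apply: chain_ext => i /=.
by rewrite compBl -!compA rf gf !cbi subr0.
Qed.

Lemma extension_split_epi : split_epi g <-> null xi.
Proof. by rewrite -[xi in null xi]compm1 extension_lift. Qed.

Lemma extension_split_mono : split_mono f <-> null xi.
Proof.
by rewrite -[xi in null xi]comp1m -shift_map1 extension_extend.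
Qed.

(** An endomorphism of the middle term over [Z] induces on [X] an endomorphism
    [U] that fixes the class [xi].  Then [idm X - U] kills [xi], so it is not
    invertible, and [U] is invertible by locality. *)
Lemma extension_right_minimal : local_end X -> ~ null xi -> right_minimal g.
Proof.
move=> loc nn h gh.
have {}gh i : g i ∘ h i = g i by rewrite -{2}gh.
pose u i := r i ∘ h i ∘ f i; pose v i := r i ∘ h i ∘ t i.
have hf i : h i ∘ f i = f i ∘ u i.
  rewrite -[h i ∘ f i]comp1m -fr compDl -!compA (compA (g i)) gh gf.
  by rewrite /u !cbi addr0 !compA.
have ht i : h i ∘ t i = f i ∘ v i + t i.
  rewrite -[h i ∘ t i]comp1m -fr compDl -!compA (compA (g i)) gh gt.
  by rewrite /v !cbi !compA.
have rh i : r i ∘ h i = u i ∘ r i + v i ∘ g i.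
  by rewrite /u /v -[LHS]compm1 -fr compDr !compA.
have uc i : cdiff X i ∘ u i = u (s i) ∘ cdiff X i.
  rewrite -[LHS]comp1m -rf -!compA (compA (f _)) -(chain_comm f) -compA -hf.
  rewrite (compA (cdiff Y i)) (chain_comm h) -(compA (h _)) (chain_comm f).
  by rewrite /u !compA.
pose U : hom X X := ChainMap uc.
have nU : null (shift_map (idm X - U) ∘ xi).
  apply/null_shift; exists v => i /=.
  have e1 : r (s i) ∘ cdiff Y i ∘ (h i ∘ t i) = cdiff X i ∘ v i + xi i.
    rewrite rd ht compDl !compDr !compA !(compKr (rf i)) (compKr (rt i)).
    by rewrite (compKr (gf i)) (compKr (gt i)) !cbi !addr0 add0r.
  have e2 : r (s i) ∘ h (s i) ∘ (cdiff Y i ∘ t i) =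
      u (s i) ∘ xi i + v (s i) ∘ cdiff Z i by rewrite dt compDr !compA.
  move: e2; rewrite compA -(compA _ _ (cdiff Y i)) -(chain_comm h).
  rewrite compA -compA e1 compBl comp1m => e2.
  by apply/eqP; rewrite subr_eq addrAC eq_sym subr_eq addrC -e2 addrC eqxx.
clearbody u v.
have [iso|[w [wU Uw]]] : is_iso (idm X - U) \/ is_iso U.
- by apply: loc.2; rewrite subrK; exists (idm X); rewrite compm1.
- case: nn; case: iso => w [wU _].
  have := null_compl (shift_map w) nU; rewrite compA -shift_mapM wU shift_map1.
  by rewrite comp1m.
apply: iso_components => i.
have wu : w i ∘ u i = idm _ by have := congr1 (fun q : hom X X => q i) wU.
have uw : u i ∘ w i = idm _ by have := congr1 (fun q : hom X X => q i) Uw.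
exists (f i ∘ w i ∘ r i - f i ∘ w i ∘ v i ∘ g i + t i ∘ g i); split.
  rewrite compDl compBl -!(compA _ _ (h i)) gh rh -fr; congr (_ + _).
  by rewrite compDr !compA (compKr wu) compm1 addrK.
rewrite compDr compBr !compA hf ht !(compKr uw) !compm1 compDl addrA subrK.
exact: fr.
Qed.

(** As for [extension_right_minimal], with the induced endomorphism of [Z]. *)
Lemma extension_left_minimal : local_end Z -> ~ null xi -> left_minimal f.
Proof.
move=> loc nn h hf.
have {}hf i : h i ∘ f i = f i by rewrite -{2}hf.
pose u i := g i ∘ h i ∘ t i; pose v i := r i ∘ h i ∘ t i.
have gh i : g i ∘ h i = u i ∘ g i.
  rewrite -[g i ∘ h i]compm1 -fr compDr !compA (compKr (hf i)) gf.
  by rewrite /u !cbi add0r.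
have rh i : r i ∘ h i = r i + v i ∘ g i.
  rewrite -[r i ∘ h i]compm1 -fr compDr !compA (compKr (hf i)) rf.
  by rewrite /v !cbi.
have ht i : h i ∘ t i = f i ∘ v i + t i ∘ u i.
  by rewrite -[h i ∘ t i]comp1m -fr compDl /u /v !compA.
have uc i : cdiff Z i ∘ u i = u (s i) ∘ cdiff Z i.
  have -> : cdiff Z i ∘ u i = g (s i) ∘ h (s i) ∘ (cdiff Y i ∘ t i).
    by rewrite /u !compA (chain_comm g) -(compA _ (cdiff Y i)) (chain_comm h)
      !compA.
  rewrite gh dt !compDr !compA (compKr (gf _)) (compKr (gt _)).
  by rewrite !cbi add0r.
pose U : hom Z Z := ChainMap uc.
have nU : null (xi ∘ (idm Z - U)).
  apply/null_shift; exists (fun i => - v i) => i /=.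
  have e1 : r (s i) ∘ cdiff Y i ∘ (h i ∘ t i) = cdiff X i ∘ v i + xi i ∘ u i.
    rewrite rd ht compDl !compDr !compA !(compKr (rf i)) (compKr (rt i)).
    by rewrite (compKr (gf i)) (compKr (gt i)) !cbi !addr0 add0r.
  have e2 : r (s i) ∘ h (s i) ∘ (cdiff Y i ∘ t i) =
      xi i + v (s i) ∘ cdiff Z i.
    rewrite dt rh compDl !compDr !compA !(compKr (gf _)) !(compKr (gt _)).
    by rewrite rf rt !cbi addr0 add0r.
  move: e2; rewrite compA -(compA _ _ (cdiff Y i)) -(chain_comm h).
  rewrite compA -compA e1 compBr compm1 compNl compNr opprK => e2.
  by apply/eqP; rewrite subr_eq -addrA e2 addrC addrK.
clearbody u v.
have [iso|[w [wU Uw]]] : is_iso (idm Z - U) \/ is_iso U.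
- by apply: loc.2; rewrite subrK; exists (idm Z); rewrite compm1.
- case: nn; case: iso => w [_ Uw].
  by have := null_compr w nU; rewrite -compA Uw compm1.
apply: iso_components => i.
have wu : w i ∘ u i = idm _ by have := congr1 (fun q : hom Z Z => q i) wU.
have uw : u i ∘ w i = idm _ by have := congr1 (fun q : hom Z Z => q i) Uw.
exists (f i ∘ r i - f i ∘ v i ∘ w i ∘ g i + t i ∘ w i ∘ g i); split.
  rewrite compDl compBl -!(compA _ _ (h i)) gh rh compDr !compA !(compKr wu).
  by rewrite !compm1 addrK fr.
rewrite compDr compBr !compA hf ht !compDl (compKr uw) compm1 addrA subrK.
exact: fr.
Qed.

End Extension.

(** The Auslander-Reiten argument: for [X] and [Z] with local endomorphism
    rings, a nonsplit extension whose class is killed by every non-split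
    epimorphism to [Z] is almost split.  Its other half follows: a map [h] out
    of [X] that does not extend to the middle term yields a nonsplit extension
    by [W], whose epimorphism kills [xi], so that [xi] factors through [h]. *)
Lemma almost_split_extension (X Z : K) (xi : hom Z (shift X : K)) :
  additive_category A -> local_end X -> local_end Z -> ~ null xi ->
  (forall W (h : hom W Z), ~ split_epi h -> null (xi ∘ h)) ->
  exists Y (f : hom X Y) (g : hom Y Z),
    almost_split_sequence (@degreewise_split I s k A) f g.
Proof.
move=> add locX locZ nn kills.
have [Y [f [g [t [r ext]]]]] := extension_exists xi add.
exists Y, f, g; split; first exact: extension_conflation ext.
- split; first exact: extension_left_minimal ext locZ nn.
  split=> [/(extension_split_mono ext)//|W h nsm].
  apply/(extension_extend ext); apply: contrapT => nh.
  have [Y' [f' [g' [t' [r' ext']]]]] := extension_exists (shift_map h ∘ xi) add.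
  have : null (xi ∘ g') by apply: kills => /(extension_split_epi ext').
  move=> /(null_shift (xi ∘ g'))[u hu].
  have [bi' dt'] := ext'.
  pose a i := u i ∘ f' i; pose b i := u i ∘ t' i.
  have gf' i : g' i ∘ f' i = 0 by case: (bi' i).
  have gt' i : g' i ∘ t' i = idm _ by case: (bi' i).
  have ac i : cdiff X i ∘ a i = a (s i) ∘ cdiff W i.
    have /= e := congr1 (comp^~ (f' i)) (hu i); move: e.
    rewrite -compA gf' comp0D compBl -(compA (u _)) (chain_comm f') /a !compA.
    by move/esym/eqP; rewrite subr_eq0 => /eqP.
  pose aa : hom W X := ChainMap ac.
  have nah : null (shift_map (idm X - aa ∘ h) ∘ xi).
    apply/null_shift; exists b => i /=.
    have /= e := congr1 (comp^~ (t' i)) (hu i); move: e.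
    rewrite -compA gt' compm1 compBl -(compA (u _)) dt' compDr /a /b /= !compA.
    by move=> e; rewrite compBl comp1m {1}e addrAC;
      congr (_ - _); rewrite addrAC subrr add0r.
  have [iso|[w [wah _]]] : is_iso (idm X - aa ∘ h) \/ is_iso (aa ∘ h).
  + by apply: locX.2; rewrite subrK; exists (idm X); rewrite compm1.
  + case: nn; case: iso => w [wU _].
    have := null_compl (shift_map w) nah; rewrite compA -shift_mapM wU.
    by rewrite shift_map1 comp1m.
  by case: nsm; exists (w ∘ aa); rewrite -compA.
split; first exact: extension_right_minimal ext locX nn.
split=> [/(extension_split_epi ext)//|W h nse].
by apply/(extension_lift ext); apply: kills.
Qed.

End Homotopy.

(** * Finiteness of the category of complexes *)

Section ComplexFiniteness.
Variables (I : finType) (s : I -> I) (k : comPzRingType) (A : klincat k).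
Hypothesis s_inj : injective s.
Local Notation K := (complex_cat s A).

(** Splitting degreewise, the image inherits the compressed differential
    [p ∘ d ∘ j]. *)
Lemma complex_idempotent_complete : idempotent_complete A ->
  idempotent_complete K.
Proof.
move=> idc X e ee.
have ei i : e i ∘ e i = e i by have := congr1 (fun q : hom X X => q i) ee.
have /(@dependent_choice _ _)[R /(@dependent_choice _ _)[j
  /(@dependent_choice _ _)[p h]]] := fun i => idc _ _ (ei i).
have pj i : p i ∘ j i = idm _ by case: (h i).
have jp i : j i ∘ p i = e i by case: (h i).
have ed i : e (s i) ∘ cdiff X i = cdiff X i ∘ e i by rewrite (chain_comm e).
have ej i : e i ∘ j i = j i by rewrite -jp (compKr (pj i)) compm1.
have pe i : p i ∘ e i = p i by rewrite -jp compA pj comp1m.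
have d2 i : (p (s (s i)) ∘ cdiff X (s i) ∘ j (s i)) ∘
    (p (s i) ∘ cdiff X i ∘ j i) = 0.
  rewrite !compA (compKr (jp _)) (compKr (ed _)) !compA (compKr (cdiffK X i)).
  by rewrite !cbi.
pose Y : K := Complex d2.
have jc i : cdiff X i ∘ j i = j (s i) ∘ (p (s i) ∘ cdiff X i ∘ j i).
  by rewrite !compA jp ed -compA ej.
have pc i : (p (s i) ∘ cdiff X i ∘ j i) ∘ p i = p (s i) ∘ cdiff X i.
  by rewrite (compKr (jp i)) -compA -ed compA pe.
exists Y, (ChainMap (X := Y) (Y := X) jc), (ChainMap (X := X) (Y := Y) pc).
by split; apply: chain_ext => i /=.
Qed.

End ComplexFiniteness.

Section TotalEmbedding.
Variables (m : nat) (k : comPzRingType) (A : klincat k).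
Variables (X Y : 'I_m -> A) (S S' : A).
Variables (e : forall j, hom (X j) S) (p : forall j, hom S (X j)).
Variables (e' : forall j, hom (Y j) S') (p' : forall j, hom S' (Y j)).

Definition total (f : forall i, hom (X i) (Y i)) : hom S S' :=
  \sum_i (e' i ∘ f i ∘ p i).

Lemma total_component f j : (forall i, p i ∘ e i = idm _) ->
  (forall i i', i != i' -> p i ∘ e i' = 0) ->
  (forall i, p' i ∘ e' i = idm _) ->
  (forall i i', i != i' -> p' i ∘ e' i' = 0) ->
  p' j ∘ total f ∘ e j = f j.
Proof.
move=> pe pe0 pe' pe0'; rewrite /total comp_sumr comp_suml (bigD1 j) //= big1.
  by rewrite !compA pe' comp1m (compKr (pe j)) compm1 addr0.
by move=> i ij; rewrite !compA pe0' ?compD0 // eq_sym.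
Qed.

Lemma total_linear c f g : total (fun i => c *: f i + g i) =
  c *: total f + total g.
Proof.
rewrite /total scaler_sumr -big_split /=; apply: eq_bigr => i _.
by rewrite compDr compDl compZr compZl.
Qed.

End TotalEmbedding.

Section ComplexRank.
Variables (m : nat) (s : 'I_m -> 'I_m) (k : comPzRingType) (A : klincat k).
Local Notation K := (complex_cat s A).

(** Chain maps embed into the maps between the total objects of [A]. *)
Lemma complex_ranked (X Y : K) : additive_category A -> hom_finite A ->
  ranked (hom X Y).
Proof.
move=> add fin.
have [S [e [p [pe pe0 _]]]] := direct_sum_exists add (cobj X).
have [S' [e' [p' [pe' pe0' _]]]] := direct_sum_exists add (cobj Y).
have lin : linear (fun f : hom X Y => total p e' (fun i => f i)).
  by move=> c f g; rewrite -total_linear.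
apply: (ranked_inj (f := mklin lin)); last exact: finite_length_ranked.
move=> f g /= fg; apply: chain_ext => j.
by rewrite -(total_component (e := e) (p := p) f j pe pe0 pe' pe0') fg
  total_component.
Qed.

End ComplexRank.

(** * Complexes of functors and their representing complexes *)

Section Functors.
Variables (k : comPzRingType) (A : klincat k).
Implicit Types F G H : modA A.

Lemma nt_ext F G (a b : nat_trans F G) : (forall X u, a X u = b X u) -> a = b.
Proof.
case: a b => [a ha] [b hb] /= ab.
have {}ab : a = b.
  by apply: functional_extensionality_dep => X; apply: lin_ext => u; apply: ab.
by subst b; rewrite (Prop_irrelevance ha hb).
Qed.

Lemma mmap_linear F (X Y : A) (u : F Y) :
  linear (fun f : hom X Y => mmap F f u).
Proof.
move=> c f g.
by have := congr1 (fun h : {linear F Y -> F X} => h u) (@mmapP k A F X Y c f g).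
Qed.

Lemma mmapD F (X Y : A) (f g : hom X Y) u :
  mmap F (f + g) u = mmap F f u + mmap F g u.
Proof. exact: (linearD (mklin (@mmap_linear F X Y u))). Qed.
Lemma mmap0 F (X Y : A) u : mmap F (0 : hom X Y) u = 0.
Proof. exact: (linear0 (mklin (@mmap_linear F X Y u))). Qed.
Lemma mmapZ F (X Y : A) c (f : hom X Y) u :
  mmap F (c *: f) u = c *: mmap F f u.
Proof. exact: (linearZ_LR (mklin (@mmap_linear F X Y u))). Qed.

Definition ntN F G (a : nat_trans F G) : nat_trans F G :=
  @NatTrans k A F G (fun X => - a X) (fun X Y f u =>
    etrans (congr1 -%R (nt_nat a f u)) (esym (linearN (mmap G f) (a Y u)))).

Lemma ntNK F G (a : nat_trans F G) : ntN (ntN a) = a.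
Proof. by apply: nt_ext => X u; apply: opprK. Qed.

Definition nt_comp F G H (b : nat_trans G H) (a : nat_trans F G) :
    nat_trans F H :=
  @NatTrans k A F H (fun X => (b X \o a X) : {linear F X -> H X})
    (fun X Y f u => etrans (congr1 (b X) (nt_nat a f u)) (nt_nat b f (a Y u))).

Definition nt_id F : nat_trans F F :=
  @NatTrans k A F F (fun X => idfun : {linear F X -> F X})
    (fun X Y f u => erefl).

Program Definition prodF F G : modA A :=
  @ModA k A (fun X => (F X * G X)%type : lmodType k)
    (fun X Y f => mklin (f := fun u => (mmap F f u.1, mmap G f u.2)) _)
    _ _ _.
Next Obligation. by move=> c u v /=; rewrite !linearP. Qed.
Next Obligation. by rewrite !mmap1. Qed.
Next Obligation. by rewrite !mmapM. Qed.
Next Obligation.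
by move=> c f g; apply: lin_ext => u /=; rewrite !mmapD !mmapZ.
Qed.

Program Definition nt_pair F G H (a : nat_trans F G) (b : nat_trans F H) :
    nat_trans F (prodF G H) :=
  @NatTrans k A F (prodF G H) (fun X => mklin (f := fun u => (a X u, b X u)) _)
    _.
Next Obligation. by move=> c u v /=; rewrite !linearP. Qed.
Next Obligation. by rewrite !nt_nat. Qed.

Program Definition nt_copair F G H (a : nat_trans F H) (b : nat_trans G H) :
    nat_trans (prodF F G) H :=
  @NatTrans k A (prodF F G) H
    (fun X => mklin (f := fun u => a X u.1 + b X u.2) _) _.
Next Obligation.
by move=> c u v /=; rewrite !linearP /= scalerDr addrACA.
Qed.
Next Obligation. by rewrite !nt_nat linearD. Qed.

Definition ntD F G (a b : nat_trans F G) : nat_trans F G :=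
  @NatTrans k A F G (fun X => a X + b X) (fun X Y f u =>
    etrans (congr2 +%R (nt_nat a f u) (nt_nat b f u))
      (esym (linearD (mmap G f) (a Y u) (b Y u)))).

Program Definition nt_zero F G : nat_trans F G :=
  @NatTrans k A F G (fun X => 0) _.
Next Obligation. by rewrite linear0. Qed.

Definition short_exact F G H (a : nat_trans F G) (b : nat_trans G H) : Prop :=
  [/\ nt_injective a, nt_exact a b & nt_surjective b].

End Functors.

Section FunctorComplexes.
Variables (I : finType) (s : I -> I) (k : comPzRingType) (A : klincat k).
Hypothesis s_inj : injective s.
Local Notation K := (complex_cat s A).

Record fcomplex := FComplex {
  fobj :> I -> modA A;
  fdiff : forall i, nat_trans (fobj i) (fobj (s i));
  fdiffK : forall i X (u : fobj i X), fdiff (s i) X (fdiff i X u) = 0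
}.

Definition fshift (M : fcomplex) : fcomplex :=
  @FComplex (fun i => M (s i)) (fun i => ntN (fdiff M (s i)))
    (fun i X u => etrans (congr1 -%R (linearN _ _))
      (etrans (opprK _) (fdiffK u))).

(** Coresolving a complex [M] shifts in the direction opposite to resolving it,
    so that [M] has to be presented as a shift. *)
Lemma funshift M : exists N, M = fshift N.
Proof.
case: M => X d d2.
have [X0 eX] : exists X0 : I -> modA A, X = fun i => X0 (s i).
  have [X0 h] := reindex_succ s_inj (T := fun=> modA A) X.
  by exists X0; apply: funext => i; rewrite h.
subst X.
have [d' hd'] := reindex_succ s_inj
  (T := fun j => nat_trans (X0 j) (X0 (s j))) (fun i => ntN (d i)).
have d2' : forall j X (u : X0 j X), d' (s j) X (d' j X u) = 0.
  apply: (all_succ s_inj) => i X u; rewrite !hd' /=.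
  by rewrite -[RHS](d2 i X u); rewrite linearN /= opprK.
exists (FComplex d2'); rewrite /fshift /=.
have {hd'} e : d = fun i => ntN (d' (s i)).
  by apply: functional_extensionality_dep => i; rewrite hd' ntNK.
subst d; congr FComplex; exact: Prop_irrelevance.
Qed.

(** Cocycles are the chain maps from the complex represented by [Y] to [M],
    read through the Yoneda lemma; boundaries are the null-homotopic ones. *)
Definition cocycle (Y : K) (M : fcomplex) (u : forall i, M i (cobj Y i)) :
    Prop :=
  forall i, fdiff M i _ (u i) = mmap (M (s i)) (cdiff Y i) (u (s i)).

Definition boundary (Y : K) (M : fcomplex) (u : forall i, M i (cobj Y i)) :
    Prop :=
  exists h : forall i, M i (cobj Y (s i)), forall i,
    u (s i) = fdiff M i _ (h i) + mmap (M (s i)) (cdiff Y (s i)) (h (s i)).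

Definition pull (Q Y : K) (M : fcomplex) (u : forall i, M i (cobj Q i))
    (f : hom Y Q) : forall i, M i (cobj Y i) := fun i => mmap (M i) (f i) (u i).

(** [u] induces an isomorphism between maps [Y -> Q] up to homotopy and
    cohomology classes of [Y] with values in [M]. *)
Definition represents (Q : K) (M : fcomplex) (u : forall i, M i (cobj Q i)) :
    Prop :=
  [/\ cocycle u,
      forall (Y : K) (v : forall i, M i (cobj Y i)), cocycle v ->
        exists f : hom Y Q, boundary (fun i => v i - pull u f i) &
      forall (Y : K) (f : hom Y Q), boundary (pull u f) -> null f].

Definition representable (Q : K) (M : fcomplex) : Prop :=
  exists u : forall i, M i (cobj Q i), represents u.

(** Dimension shifting: when [L] is contractible, the connecting map identifies
    the classes with values in [M] with those with values in [fshift N]. *)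
Lemma representable_step (N L M : fcomplex) (j : forall i, nat_trans (N i) (L i))
    (p : forall i, nat_trans (L i) (M i))
    (c : forall i, nat_trans (L (s i)) (L i)) (Q : K) :
  (forall i X u, fdiff L i X (j i X u) = j (s i) X (fdiff N i X u)) ->
  (forall i X u, fdiff M i X (p i X u) = p (s i) X (fdiff L i X u)) ->
  (forall i, short_exact (j i) (p i)) ->
  (forall i X u, fdiff L i X (c i X u) + c (s i) X (fdiff L (s i) X u) = u) ->
  representable Q (fshift N) -> representable Q M.
Proof.
move=> jd pd jp cc [w [cw hw1 hw2]].
have jI i X u v : j i X u = j i X v -> u = v by case: (jp i) => h _ _; apply: h.
have pj i X u : p i X (j i X u) = 0.
  by case: (jp i) => _ h _; apply/h; exists u.
have jE i X l : p i X l = 0 -> exists u, j i X u = l.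
  by case: (jp i) => _ h _ /h.
have pS i X v : exists l, p i X l = v by case: (jp i).
(* Since [L] is contractible, the cocycle [j w] bounds [l], whose image in [M] is
   the class that the connecting map sends to [w]. *)
pose l i := c i _ (j (s i) _ (w i)).
have {}cw i : - fdiff N (s i) _ (w i) = mmap (N (s (s i))) (cdiff Q i) (w (s i)).
  exact: cw i.
have dl i : fdiff L i _ (l i) =
    j (s i) _ (w i) + mmap (L (s i)) (cdiff Q i) (l (s i)).
  rewrite -[j _ _ _ in RHS](cc i) -/(l i) jd.
  rewrite -[fdiff N _ _ _]opprK cw !linearN /= (nt_nat (j _)) (nt_nat (c _)).
  by rewrite subrK.
pose u i := p i _ (l i).
have cu : cocycle u.
  by move=> i; rewrite /u pd dl linearD /= pj add0r nt_nat.
exists u; split=> // Y.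
  move=> v cv.
  have /(@dependent_choice _ _)[t pt] := fun i => pS i _ (v i).
  have /(@dependent_choice _ _)[n jn] : forall i, exists n : N (s i) (cobj Y i),
      j (s i) _ n = fdiff L i _ (t i) - mmap (L (s i)) (cdiff Y i) (t (s i)).
    by move=> i; apply: jE; rewrite linearB /= -pd pt cv -pt nt_nat subrr.
  have cn : cocycle (M := fshift N) n.
    move=> i /=; apply: jI; rewrite linearN /= -jd jn nt_nat jn.
    by rewrite !linearB /= fdiffK oppr0 sub0r opprK nt_nat -mmapM cdiffK mmap0 subr0.
  have [f [h hf]] := hw1 _ _ cn; exists f.
  have {}hf i : n (s i) - mmap _ (f (s i)) (w (s i)) =
    - fdiff N (s i) _ (h i) + mmap (N (s (s i))) (cdiff Y (s i)) (h (s i)).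
    exact: hf i.
  have [h' hh'] := reindex_succ s_inj (T := fun i => N i (cobj Y i)) h.
  pose y i := t i - mmap (L i) (f i) (l i).
  have dy i : fdiff L i _ (y i) = j (s i) _ (n i - mmap (N (s i)) (f i) (w i)) +
      mmap (L (s i)) (cdiff Y i) (y (s i)).
    rewrite /y !linearB /= nt_nat dl jn linearD /= -!nt_nat -!mmapM.
    rewrite (chain_comm f) opprD !addrA; congr (_ - _).
    by rewrite addrAC subrK.
  have yE i : y i = t i - mmap (L i) (f i) (l i) by [].
  clearbody y; pose x i := y i + j i _ (h' i).
  have cx : forall i, fdiff L i _ (x i) = mmap (L (s i)) (cdiff Y i) (x (s i)).
    apply: (all_succ s_inj) => i.
    rewrite /x !hh' !linearD /= dy hf linearD linearN /= jd nt_nat.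
    by rewrite addrC !addrA subrr add0r addrC.
  have bx i : x (s i) = fdiff L i _ (c i _ (x (s i))) +
      mmap (L (s i)) (cdiff Y (s i)) (c (s i) _ (x (s (s i)))).
    by rewrite -nt_nat -cx cc.
  exists (fun i => p i _ (c i _ (x (s i)))) => i.
  rewrite pd -nt_nat -linearD -bx /x yE linearD linearB /= pj addr0 pt.
  by rewrite nt_nat.
move=> f [h hf].
have /(@dependent_choice _ _)[g pg] := fun i => pS i _ (h i).
have /(@dependent_choice _ _)[n jn] : forall i,
    exists n : N (s i) (cobj Y (s i)), j (s i) _ n =
      mmap (L (s i)) (f (s i)) (l (s i)) - fdiff L i _ (g i) -
      mmap (L (s i)) (cdiff Y (s i)) (g (s i)).
  move=> i; apply: jE; rewrite !linearB /= -pd !nt_nat !pg.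
  by have := hf i; rewrite /pull /u => ->; rewrite -addrA -opprD subrr.
apply: hw2; exists (fun i => - n i) => i; rewrite /pull /= linearN opprK.
apply: jI; rewrite linearN linearB /= -jd nt_nat jn nt_nat jn.
have dlf : fdiff L (s i) _ (mmap (L (s i)) (f (s i)) (l (s i))) =
    mmap (L (s (s i))) (f (s i)) (j (s (s i)) _ (w (s i))) +
    mmap (L (s (s i))) (cdiff Y (s i))
      (mmap (L (s (s i))) (f (s (s i))) (l (s (s i)))).
  by rewrite nt_nat dl linearD /= -!mmapM (chain_comm f).
rewrite !linearB /= fdiffK dlf nt_nat -(mmapM (cdiff Y (s (s i)))) cdiffK mmap0.
by rewrite subr0 !opprK addr0 addrACA addrK addNr addr0.
Qed.

End FunctorComplexes.

(** * Complexes of functors of finite projective dimension are representable *)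

Section Subfunctors.
Variables (k : comPzRingType) (A : klincat k) (F : modA A).
Variable W : forall X : A, set (F X).
Hypothesis hW : forall X, submodule (@W X).
Hypothesis stable : forall (X Y : A) (f : hom X Y) u, W u -> W (mmap F f u).

Program Definition subF : modA A :=
  @ModA k A (fun X => submod (@hW X)) (fun X Y f =>
    mklin (f := fun u : submod (@hW Y) =>
      exist _ (mmap F f (sval u)) (stable f (svalP u)) : submod (@hW X)) _)
    _ _ _.
Next Obligation. by move=> c u v; apply: submod_inj; rewrite /= linearP. Qed.
Next Obligation. by apply: submod_inj; rewrite /= mmap1. Qed.
Next Obligation. by apply: submod_inj; rewrite /= mmapM. Qed.
Next Obligation.
move=> c f g; apply: lin_ext => u; apply: submod_inj => /=.
by rewrite mmapD mmapZ.
Qed.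

Definition sub_incl : nat_trans subF F :=
  @NatTrans k A subF F (fun X => submod_val (@hW X)) (fun X Y f u => erefl).

Lemma sub_incl_inj : nt_injective sub_incl.
Proof. by move=> X; apply: submod_val_inj. Qed.

Lemma sub_incl_mem X (u : F X) : W u -> exists v, sub_incl X v = u.
Proof. by move=> h; exists (exist _ u h : submod (@hW X)). Qed.

Lemma sub_incl_val X (v : subF X) : W (sub_incl X v).
Proof. exact: (svalP v). Qed.

End Subfunctors.

Section Kernels.
Variables (k : comPzRingType) (A : klincat k).
Implicit Types F G H : modA A.

Lemma nt_corestrict F G H (j : nat_trans G H) (a : nat_trans F H) :
  nt_injective j -> (forall X u, exists v, j X v = a X u) ->
  exists b : nat_trans F G, forall X u, j X (b X u) = a X u.
Proof.
move=> jI h.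
have /(@dependent_choice _ _)[b hb] := fun X => dependent_choice (h X).
have lin X : linear (b X).
  by move=> c u v; apply: (jI X); rewrite linearP !hb linearP.
unshelve eexists (@NatTrans k A F G (fun X => mklin (lin X)) _).
  by move=> X Y f u; apply: (jI X); rewrite /= hb !nt_nat /= hb.
exact: hb.
Qed.

Lemma nt_descend F G H (p : nat_trans F G) (a : nat_trans F H) :
  nt_surjective p -> (forall X u, p X u = 0 -> a X u = 0) ->
  exists b : nat_trans G H, forall X u, b X (p X u) = a X u.
Proof.
move=> pS ker.
have /(@dependent_choice _ _)[t ht] := fun X => dependent_choice (pS X).
have aE X u v : p X u = p X v -> a X u = a X v.
  move=> e; apply/eqP; rewrite -subr_eq0 -linearB; apply/eqP/ker.
  by rewrite linearB /= e subrr.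
have lin X : linear (fun v => a X (t X v)).
  by move=> c u v; rewrite -linearP; apply: aE; rewrite linearP !ht.
unshelve eexists (@NatTrans k A G H (fun X => mklin (lin X)) _).
  by move=> X Y f u /=; rewrite -nt_nat; apply: aE; rewrite nt_nat !ht.
by move=> X u /=; apply: aE; rewrite ht.
Qed.

Lemma kernel_exists F G (p : nat_trans F G) :
  exists K (j : nat_trans K F), nt_injective j /\ nt_exact j p.
Proof.
pose W X := [set u | p X u = 0].
have hW X : submodule (W X).
  split; first exact: linear0.
  by move=> c u v; rewrite /W /= => hu hv; rewrite linearP hu hv scaler0 addr0.
have st (X Y : A) (f : hom X Y) u : W Y u -> W X (mmap F f u).
  by rewrite /W /= nt_nat => ->; rewrite linear0.
exists (subF hW st), (sub_incl hW st); split; first exact: sub_incl_inj.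
move=> X u; split=> [h|[v <-]]; first exact: sub_incl_mem.
exact: (sub_incl_val (v : subF hW st X)).
Qed.

Program Definition nt_yoneda F (X : A) (x : F X) :
    nat_trans (hom_functor X) F :=
  @NatTrans k A (hom_functor X) F
    (fun Y => mklin (f := fun f => mmap F f x) (@mmap_linear k A F Y X x)) _.
Next Obligation. by rewrite mmapM. Qed.

Lemma yonedaE F (X Y : A) (a : nat_trans (hom_functor X) F) (f : hom Y X) :
  a Y f = mmap F f (a X (idm X)).
Proof. by rewrite -nt_nat /= comp1m. Qed.

End Kernels.

Section Cofree.
Variables (I : finType) (s : I -> I) (k : comPzRingType) (A : klincat k).
Variable G : I -> modA A.

(** The contractible complex freely generated by [G], up to a shift: maps into it
    are graded maps into [G], and maps out of it are graded maps out of the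
    second summands. *)
Program Definition cofree : fcomplex s A :=
  @FComplex I s k A (fun i => prodF (G i) (G (s i)))
    (fun i => @NatTrans k A (prodF (G i) (G (s i)))
      (prodF (G (s i)) (G (s (s i))))
      (fun X => mklin (f := fun u => (u.2, 0)) _) _) _.
Next Obligation.
move=> c u v; rewrite [RHS](_ : _ = (c *: u.2 + v.2, c *: 0 + 0)) //.
by rewrite scaler0 addr0.
Qed.
Next Obligation. by rewrite linear0. Qed.

Program Definition cofree_contraction i :
    nat_trans (cofree (s i)) (cofree i) :=
  @NatTrans k A (cofree (s i)) (cofree i)
    (fun X => mklin (f := fun u => (0, u.1)) _) _.
Next Obligation.
move=> c u v; rewrite [RHS](_ : _ = (c *: 0 + 0, c *: u.1 + v.1)) //.
by rewrite scaler0 addr0.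
Qed.
Next Obligation. by rewrite linear0. Qed.

Lemma cofree_contractible i X u :
  fdiff cofree i X (cofree_contraction i X u) +
  cofree_contraction (s i) X (fdiff cofree (s i) X u) = u.
Proof. by case: u => a b; rewrite /=; congr (_, _); rewrite ?addr0 ?add0r. Qed.

End Cofree.

Section RepresentableTransfer.
Variables (I : finType) (s : I -> I) (k : comPzRingType) (A : klincat k).
Hypothesis s_inj : injective s.
Local Notation K := (complex_cat s A).

Lemma post_natural (X Y : A) (g : hom X Y) (Z W : A) (f : hom Z W)
  (u : hom W X) : g ∘ (u ∘ f) = (g ∘ u) ∘ f.
Proof. exact: compA. Qed.

Definition nt_post (X Y : A) (g : hom X Y) :
    nat_trans (hom_functor X) (hom_functor Y) :=
  @NatTrans k A (hom_functor X) (hom_functor Y)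
    (fun Z => mklin (@compPr k A Z X Y g)) (post_natural g).

Program Definition hom_complex (Q : K) : fcomplex s A :=
  @FComplex I s k A (fun i => hom_functor (cobj Q i))
    (fun i => nt_post (cdiff Q i)) _.
Next Obligation. by rewrite compA cdiffK compD0. Qed.

Lemma representable_hom (Q : K) : representable Q (hom_complex Q).
Proof.
exists (fun i => idm (cobj Q i)); split.
- by move=> i /=; rewrite comp1m compm1.
- move=> Y v cv.
  have fc i : cdiff Q i ∘ v i = v (s i) ∘ cdiff Y i by exact: cv i.
  exists (ChainMap fc), (fun=> 0) => i.
  by rewrite /pull /= comp1m subrr comp0D compD0 addr0.
by move=> Y f [h hf]; exists h => i; have := hf i; rewrite /pull /= comp1m.
Qed.

Lemma representable_iso (M N : fcomplex s A)
    (a : forall i, nat_trans (M i) (N i)) (Q : K) :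
  (forall i X u, fdiff N i X (a i X u) = a (s i) X (fdiff M i X u)) ->
  (forall i, nt_injective (a i)) -> (forall i, nt_surjective (a i)) ->
  representable Q M -> representable Q N.
Proof.
move=> ad aI aS [u [cu u1 u2]].
exists (fun i => a i _ (u i)); split.
- by move=> i; rewrite ad cu nt_nat.
- move=> Y v cv.
  have /(@dependent_choice _ _)[t ht] := fun i => aS i _ (v i).
  have ct : cocycle t.
    by move=> i; apply: aI; rewrite -ad nt_nat !ht.
  have [f [h hf]] := u1 _ _ ct; exists f, (fun i => a i _ (h i)) => i.
  rewrite /pull ad -!nt_nat -linearD -hf /pull.
  by rewrite linearB /= ht.
move=> Y f [h hf]; apply: u2.
have /(@dependent_choice _ _)[t ht] := fun i => aS i _ (h i).
exists t => i; apply: (aI (s i)); have := hf i.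
by rewrite /pull linearD /= -ad !nt_nat !ht.
Qed.

End RepresentableTransfer.

Section ProjectiveResolutions.
Variables (k : comPzRingType) (A : klincat k).
Hypothesis add : additive_category A.

(** Finite resolutions by representable functors, cut into short exact sequences
    because dimension shifting consumes one of these at a time. *)
Fixpoint proj_res (d : nat) (F : modA A) : Prop :=
  if d is d'.+1 then
    exists (R : A) (N : modA A) (j : nat_trans N (hom_functor R))
      (p : nat_trans (hom_functor R) F), short_exact j p /\ proj_res d' N
  else exists (R : A) (a : nat_trans (hom_functor R) F),
    nt_injective a /\ nt_surjective a.

(** An extension by a representable functor splits, so it does not raise the
    length of a resolution. *)
Lemma proj_res_extension d (K N : modA A) (V : A) (j : nat_trans K N)
    (q : nat_trans N (hom_functor V)) :
  short_exact j q -> proj_res d K -> proj_res d N.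
Proof.
move=> [jI jq qS].
have qj X u : q X (j X u) = 0 by apply/jq; exists u.
have [n qn] := qS V (idm V).
have qnf (X : A) (f : hom X V) : q X (mmap N f n) = f.
  by rewrite nt_nat qn /= comp1m.
have lift R (b : nat_trans (hom_functor R) K) : exists (S : A) (p1 : hom S R)
    (p2 : hom S V) (i1 : hom R S) (i2 : hom V S)
    (c : nat_trans (hom_functor S) N), biproduct i1 i2 p1 p2 /\
    forall (X : A) (f : hom X S),
      c X f = j X (b X (p1 ∘ f)) + mmap N (p2 ∘ f) n.
  have [S [i1 [i2 [p1 [p2 bi]]]]] := add.2 R V.
  exists S, p1, p2, i1, i2.
  exists (nt_yoneda (j S (b S p1) + mmap N p2 n)); split=> // X f /=.
  by rewrite linearD /= -(nt_nat j) -(nt_nat b f p1) -mmapM.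
have joint (S R : A) (i1 : hom R S) (i2 : hom V S) p1 p2 (X : A)
    (f : hom X S) : biproduct i1 i2 p1 p2 -> p1 ∘ f = 0 -> p2 ∘ f = 0 -> f = 0.
  move=> [_ _ _ _ e] h1 h2.
  by rewrite -[f]comp1m -e compDl -!compA h1 h2 !comp0D addr0.
have zero R (b : nat_trans (hom_functor R) K) (S : A) (p1 : hom S R)
    (p2 : hom S V) (c : nat_trans (hom_functor S) N) :
    (forall (X : A) (f : hom X S),
      c X f = j X (b X (p1 ∘ f)) + mmap N (p2 ∘ f) n) ->
    forall (X : A) (f : hom X S), c X f = 0 <->
      b X (p1 ∘ f) = 0 /\ p2 ∘ f = 0.
  move=> cE X f; rewrite cE; split=> [e|[-> ->]]; last first.
    by rewrite linear0 mmap0 addr0.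
  have p2f : p2 ∘ f = 0.
    by have := congr1 (q X) e; rewrite linearD /= qj add0r qnf linear0.
  split=> //; apply: (jI X); move: e.
  by rewrite p2f mmap0 addr0 linear0.
have surj R (b : nat_trans (hom_functor R) K) (S : A) (p1 : hom S R)
    (p2 : hom S V) i1 i2 (c : nat_trans (hom_functor S) N) :
    biproduct i1 i2 p1 p2 -> (forall (X : A) (f : hom X S),
      c X f = j X (b X (p1 ∘ f)) + mmap N (p2 ∘ f) n) ->
    nt_surjective b -> nt_surjective c.
  move=> [h1 h2 h3 h4 _] cE bS X v.
  have [w jw] : exists w, j X w = v - mmap N (q X v) n.
    by apply/jq; rewrite linearB /= qnf subrr.
  have [g bg] := bS X w; exists (i1 ∘ g + i2 ∘ q X v).
  rewrite cE !compDr !compA h1 h2 h3 h4 !cbi addr0 add0r bg jw.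
  by rewrite subrK.
case: d => [[R [b [bI bS]]]|d [R [N' [j' [b [[j'I j'b bS] pN']]]]]].
  have [S [p1 [p2 [i1 [i2 [c [bi cE]]]]]]] := lift R b.
  exists S, c; split; last exact: surj bi cE bS.
  move=> X f g e; apply/eqP; rewrite -subr_eq0; apply/eqP.
  have /(zero _ _ _ _ _ _ cE)[h1 h2] : c X (f - g) = 0.
    by rewrite linearB /= e subrr.
  by apply: (joint _ _ _ _ _ _ _ _ bi) => //; apply: (bI X); rewrite linear0.
have [S [p1 [p2 [i1 [i2 [c [bi cE]]]]]]] := lift R b.
exists S, N', (nt_comp (nt_post i1) j'), c; split=> //; split.
- move=> X u v /= e; apply: (j'I X).
  by have := congr1 (comp p1) e; case: bi => h _ _ _ _; rewrite !compA h !cbi.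
- move=> X f; rewrite (zero _ _ _ _ _ _ cE); split.
    move=> [/j'b[u hu] h2]; exists u; rewrite /= hu.
    case: bi => _ _ _ _ e.
    by rewrite -[RHS]comp1m -e compDl -!compA h2 comp0D addr0.
  case: bi => h1 _ _ h4 _ [u <-] /=; rewrite !compA h1 h4 !cbi; split=> //.
  by apply/j'b; exists u.
exact: surj bi cE bS.
Qed.

Variables (I : finType) (s : I -> I).
Hypothesis s_inj : injective s.
Local Notation K := (complex_cat s A).

(** Covering every term by a representable functor covers the complex by a
    contractible one, and the kernel has a shorter resolution in each degree. *)
Lemma proj_step d (M : fcomplex s A) : (forall i, proj_res d.+1 (M i)) ->
  exists N : fcomplex s A, (forall i, proj_res d (N i)) /\
    forall Q : K, representable Q (fshift N) -> representable Q M.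
Proof.
move=> /(@dependent_choice _ _)[R /(@dependent_choice _ _)[N0
  /(@dependent_choice _ _)[j0 /(@dependent_choice _ _)[p h]]]].
have [V eV] : exists V : I -> A, R = fun i => V (s i).
  have [V hV] := reindex_succ s_inj (T := fun=> ob A) R.
  by exists V; apply: funext => i; rewrite hV.
subst R.
(* [rho] is forced by the requirement that [P] below is a chain map. *)
have [rho hrho] := reindex_succ s_inj
  (T := fun j => nat_trans (hom_functor (V j)) (M j))
  (fun i => nt_comp (fdiff M i) (p i)).
have drho : forall i X u, fdiff M i X (rho i X u) = 0.
  by apply: (all_succ s_inj) => i X u; rewrite hrho /= fdiffK.
pose L := cofree s (fun j => hom_functor (V j)).
pose P i : nat_trans (L i) (M i) := nt_copair (rho i) (p i).
have Pd i X u : fdiff M i X (P i X u) = P (s i) X (fdiff L i X u).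
  by rewrite /= linearD /= drho add0r linear0 addr0 hrho.
have /(@dependent_choice _ _)[N /(@dependent_choice _ _)[j jP]] :=
  fun i => kernel_exists (P i).
have /(@dependent_choice _ _)[d' jd] i : exists d' : nat_trans (N i) (N (s i)),
    forall X u, j (s i) X (d' X u) = fdiff L i X (j i X u).
  apply: (nt_corestrict (a := nt_comp (fdiff L i) (j i))) => [|X u].
    by case: (jP (s i)).
  apply/(jP (s i)).2; rewrite -Pd; have -> : P i X (j i X u) = 0.
    by apply/(jP i).2; exists u.
  exact: linear0.
have d2 i X u : d' (s i) X (d' i X u) = 0.
  apply: ((jP (s (s i))).1 X); rewrite !jd fdiffK; exact/esym/linear0.
exists (FComplex d2); split.
  move=> i; have [[j0I j0p pS] pN] := h i.
  (* The first projection makes [N i] an extension of [hom_functor (V i)] by the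
     syzygy [N0 i] of [M i]. *)
  pose q : nat_trans (N i) (hom_functor (V i)) :=
    nt_comp (nt_copair (nt_id _) (nt_post 0)) (j i).
  have qE X u : q X u = (j i X u).1.
    by rewrite /q /= compD0 addr0.
  have [l hl] : exists l : nat_trans (N0 i) (N i), forall X u,
      j i X (l X u) = (0, j0 i X u).
    have ht X : linear (fun u : N0 i X => (0, j0 i X u) : L i X).
      move=> c u v; rewrite [RHS](_ : _ = (c *: 0 + 0,
        c *: j0 i X u + j0 i X v)) // scaler0 addr0 linearP //.
    have nat (X Y : A) (f : hom X Y) u : (0, j0 i X (mmap (N0 i) f u)) =
        mmap (L i) f (0, j0 i Y u).
      by rewrite /= compD0 nt_nat.
    apply: (nt_corestrict (a := @NatTrans k A (N0 i) (L i)
      (fun X => mklin (ht X)) nat)) => [|X u]; first by case: (jP i).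
    apply/(jP i).2; rewrite /= linear0 add0r.
    by apply/j0p; exists u.
  apply: (proj_res_extension (j := l) (q := q)) pN; split.
  - move=> X u v e; apply: (j0I X).
    by have := congr1 (j i X) e; rewrite !hl => -[].
  - move=> X u; rewrite qE; split=> [e|[v <-]]; last by rewrite hl.
    have e0 : P i X (j i X u) = 0 by apply/(jP i).2; exists u.
    have /j0p[v hv] : p i X (j i X u).2 = 0.
      by move: e0; rewrite /= e linear0 add0r.
    exists v; apply: ((jP i).1 X); rewrite hl hv -e.
    by case: (j i X u).
  move=> X v; have [w hw] := pS X (- rho i X v).
  have [u hu] : exists u, j i X u = (v, w).
    by apply/(jP i).2; rewrite /= hw subrr.
  by exists u; rewrite qE hu.
move=> Q; apply: (representable_step (N := FComplex d2) s_inj (j := j) (p := P)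
  (c := cofree_contraction s (fun j => hom_functor (V j)))) => //.
- move=> i; split; [by case: (jP i)|by case: (jP i)|].
  move=> X v; have [[_ _ pS] _] := h i; have [w hw] := pS X v.
  by exists (0, w); rewrite /= linear0 add0r.
by move=> i X u; apply: cofree_contractible.
Qed.

(** In the base case the terms are representable and the Yoneda lemma turns the
    differential of [M] into one over [A]. *)
Theorem proj_representable d (M : fcomplex s A) :
  (forall i, proj_res d (M i)) -> exists Q : K, representable Q M.
Proof.
elim: d M => [|d IH] M; last first.
  move=> /proj_step[N [hN rN]].
  have [Q hQ] := IH (fshift N) (fun i => hN (s i)).
  by exists Q; apply: rN.
move=> /(@dependent_choice _ _)[R /(@dependent_choice _ _)[a ha]].
have aI i : nt_injective (a i) by case: (ha i).
have aS i : nt_surjective (a i) by case: (ha i).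
have /(@dependent_choice _ _)[d hd] i : exists d : hom (R i) (R (s i)),
    a (s i) _ d = fdiff M i _ (a i _ (idm (R i))) by apply: aS.
have aE i X f : a (s i) X (d i ∘ f) = fdiff M i X (a i X f).
  by rewrite (yonedaE (a i)) nt_nat -hd -nt_nat.
have d2 i : d (s i) ∘ d i = 0.
  by apply: (aI (s (s i))); rewrite aE hd fdiffK linear0.
pose Q : K := Complex d2.
exists Q; apply: (representable_iso (M := hom_complex Q) (a := a)) => //; last first.
  exact: representable_hom.
by move=> i X u; rewrite aE.
Qed.

End ProjectiveResolutions.

(** * The functors dual to representables *)

Section DualFunctors.
Variables (k : comPzRingType) (A : klincat k) (E : lmodType k).
Hypothesis E_inj : injective_module E.
Implicit Types F G H : modA A.
Local Notation D := (dual_hom_functor E).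

Program Definition nt_dual (X Y : A) (g : hom X Y) : nat_trans (D X) (D Y) :=
  @NatTrans k A (D X) (D Y) (fun Z => mklin (f :=
    fun phi : {linear hom X Z -> E} =>
      mklin (f := fun f : hom Y Z => phi (f ∘ g)) _ : D Y Z) _) _.
Next Obligation. by move=> c f f'; rewrite compPl linearP. Qed.
Next Obligation. by move=> c phi psi; apply: lin_ext. Qed.
Next Obligation. by apply: lin_ext => f' /=; rewrite compA. Qed.

Lemma nt_dualM (X Y Z : A) (g : hom Y Z) (f : hom X Y) (W : A) phi :
  nt_dual (g ∘ f) W phi = nt_dual g W (nt_dual f W phi).
Proof. by apply: lin_ext => h /=; rewrite compA. Qed.

Lemma nt_dual1 (X W : A) phi : nt_dual (idm X) W phi = phi.
Proof. by apply: lin_ext => h /=; rewrite compm1. Qed.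

Lemma nt_dual0 (X Y W : A) phi : nt_dual (0 : hom X Y) W phi = 0.
Proof. by apply: lin_ext => h /=; rewrite comp0D linear0. Qed.

Lemma nt_dualD (X Y W : A) (f g : hom X Y) phi :
  nt_dual (f + g) W phi = nt_dual f W phi + nt_dual g W phi.
Proof. by apply: lin_ext => h /=; rewrite compDr linearD. Qed.

(** The adjunction between evaluation at [T] and [D]: transformations from [F]
    to [D T] are functionals on [F T]. *)
Program Definition nt_coyoneda F (T : A) (phi : {linear F T -> E}) :
    nat_trans F (D T) :=
  @NatTrans k A F (D T) (fun X => mklin (f := fun u =>
    mklin (f := fun f : hom T X => phi (mmap F f u)) _ : D T X) _) _.
Next Obligation. by move=> c f g; rewrite mmap_linear linearP. Qed.
Next Obligation. by move=> c u v; apply: lin_ext => f /=; rewrite !linearP. Qed.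
Next Obligation. by apply: lin_ext => g /=; rewrite mmapM. Qed.

Lemma coyonedaE F (T X : A) (b : nat_trans F (D T)) u (f : hom T X) :
  (b X u : {linear hom T X -> E}) f =
  (b T (mmap F f u) : {linear hom T T -> E}) (idm T).
Proof. by rewrite nt_nat /= compm1. Qed.

Lemma dual_functor_extend F G (T : A) (a : nat_trans F G)
    (b : nat_trans F (D T)) : nt_injective a ->
  exists b' : nat_trans G (D T), forall X u, b' X (a X u) = b X u.
Proof.
move=> aI.
have lin : linear (fun u : F T => (b T u : {linear hom T T -> E}) (idm T)).
  by move=> c u v; rewrite linearP.
have [psi hpsi] := E_inj (mklin lin) (aI T).
exists (nt_coyoneda psi) => X u; apply: lin_ext => f /=.
by rewrite -nt_nat hpsi /= -coyonedaE.
Qed.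

(** The counterpart of [proj_res], by the injective functors [D A(T, -)]. *)
Fixpoint inj_res (d : nat) (F : modA A) : Prop :=
  if d is d'.+1 then
    exists (T : A) (C : modA A) (a : nat_trans F (D T))
      (c : nat_trans (D T) C), short_exact a c /\ inj_res d' C
  else exists (T : A) (a : nat_trans (D T) F),
    nt_injective a /\ nt_surjective a.

Lemma inj_res_prod d F (T : A) : additive_category A -> inj_res d F ->
  inj_res d (prodF F (D T)).
Proof.
move=> [_ sum2].
have split (R S : A) (i1 : hom R S) (i2 : hom T S) p1 p2 W
    (phi : D S W) : biproduct i1 i2 p1 p2 ->
    phi = nt_dual i1 W (nt_dual p1 W phi) + nt_dual i2 W (nt_dual p2 W phi).
  move=> [_ _ _ _ e].
  by rewrite -!nt_dualM -nt_dualD e nt_dual1.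
case: d => [[R [a [aI aS]]]|d [R [C [a [c [[aI ac cS] hC]]]]]].
  have [S [i1 [i2 [p1 [p2 bi]]]]] := sum2 R T; have [h1 h2 h3 h4 h5] := bi.
  exists S, (nt_pair (nt_comp a (nt_dual p1)) (nt_dual p2)); split.
    move=> X phi psi e.
    have e1 : nt_dual p1 X phi = nt_dual p1 X psi.
      by apply: aI; have := congr1 fst e.
    have e2 : nt_dual p2 X phi = nt_dual p2 X psi by have := congr1 snd e.
    by rewrite (split _ _ _ _ _ _ _ phi bi) (split _ _ _ _ _ _ _ psi bi) e1 e2.
  move=> X [v psi]; have [phi <-] := aS X v.
  exists (nt_dual i1 X phi + nt_dual i2 X psi).
  rewrite [LHS](_ : _ = (a X (nt_dual p1 X (nt_dual i1 X phi + nt_dual i2 X psi)),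
    nt_dual p2 X (nt_dual i1 X phi + nt_dual i2 X psi))) // !linearD.
  rewrite -!nt_dualM h1 h2 h3 h4 !nt_dual1 !nt_dual0.
  by rewrite linear0 addr0 add0r.
have [S [i1 [i2 [p1 [p2 bi]]]]] := sum2 R T; have [h1 h2 h3 h4 h5] := bi.
exists S, C, (nt_copair (nt_comp (nt_dual i1) a) (nt_dual i2)),
  (nt_comp c (nt_dual p1)); split=> //; split.
- move=> X [u phi] [v psi].
  rewrite [LHS](_ : _ = nt_dual i1 X (a X u) + nt_dual i2 X phi) //.
  rewrite [RHS](_ : _ = nt_dual i1 X (a X v) + nt_dual i2 X psi) // => e.
  congr (_, _).
    apply: (aI X); have := congr1 (nt_dual p1 X) e.
    by rewrite !linearD -!nt_dualM h1 h3 !nt_dual1 !nt_dual0 !addr0.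
  have := congr1 (nt_dual p2 X) e.
  by rewrite !linearD -!nt_dualM h2 h4 !nt_dual1 !nt_dual0 !add0r.
- move=> X phi; split=> [/ac[u hu]|[[u psi] <-]].
    exists (u, nt_dual p2 X phi).
    rewrite [LHS](_ : _ = nt_dual i1 X (a X u) +
      nt_dual i2 X (nt_dual p2 X phi)) // hu.
    by rewrite -split.
  rewrite [LHS](_ : _ = c X (nt_dual p1 X (nt_dual i1 X (a X u) +
    nt_dual i2 X psi))) // linearD -!nt_dualM h1 h3 nt_dual1 nt_dual0 addr0.
  by apply/ac; exists u.
move=> X v; have [phi <-] := cS X v; exists (nt_dual i1 X phi).
rewrite [LHS](_ : _ = c X (nt_dual p1 X (nt_dual i1 X phi))) //.
by rewrite -nt_dualM h1 nt_dual1.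
Qed.

Section Reflexivity.
Hypothesis E_cogen : minimal_injective_cogenerator E.
Hypothesis fin : hom_finite A.

Lemma nt_dual_faithful (X Y : A) (f g : hom X Y) :
  (forall W phi, nt_dual f W phi = nt_dual g W phi) -> f = g.
Proof.
move=> h; apply: contrapT => nfg.
have h0 : submodule [set (0 : hom X Y)].
  by split=> // c x y -> ->; rewrite /= scaler0 addr0.
have nz : ~ [set (0 : hom X Y)] (f - g).
  by move=> /= /eqP; rewrite subr_eq0 => /eqP.
have [phi [_ ne]] := cogenerate E_inj E_cogen
  (finite_length_ranked (fin X Y)) h0 nz.
apply: ne; rewrite linearB.
have := congr1 (fun q : {linear hom Y Y -> E} => q (idm Y)) (h Y phi).
by rewrite /= !comp1m => ->; rewrite subrr.
Qed.

(** Full faithfulness of [D]: a map between duals of representables is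
    determined by a functional on a dual module of finite length, hence by an
    evaluation. *)
Lemma nt_dual_full (X Y : A) (a : nat_trans (D X) (D Y)) :
  exists g : hom X Y, forall W phi, a W phi = nt_dual g W phi.
Proof.
have lin : linear (fun phi : {linear hom X Y -> E} =>
    (a Y phi : {linear hom Y Y -> E}) (idm Y)).
  by move=> c f g; rewrite linearP.
have [g hg] := reflexive E_inj E_cogen (mklin lin) (fin X Y).
exists g => W phi; apply: lin_ext => f /=.
by have := hg (dual_map f phi); rewrite /= coyonedaE /= => <-.
Qed.

End Reflexivity.
End DualFunctors.

(** * Complexes of functors of finite injective dimension *)

Section InjectiveResolutions.
Variables (k : comPzRingType) (A : klincat k) (E : lmodType k).
Hypothesis E_inj : injective_module E.
Hypothesis add : additive_category A.
Variables (I : finType) (s : I -> I).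
Hypothesis s_inj : injective s.
Local Notation K := (complex_cat s A).
Local Notation D := (dual_hom_functor E).

(** The sign is the one for which a functional on the graded maps [T -> Y]
    vanishes on null-homotopic maps exactly when it is a cocycle. *)
Program Definition dual_complex (T : K) : fcomplex s A :=
  @FComplex I s k A (fun i => D (cobj T i))
    (fun i => nt_dual E (- cdiff T i)) _.
Next Obligation.
by apply: lin_ext => f /=; rewrite -compA compNl !compNr opprK cdiffK comp0D linear0.
Qed.

(** The mirror image of [proj_step]: every term is embedded into the dual of a
    representable functor, the complex into a contractible one. *)
Lemma inj_step d (M : fcomplex s A) : (forall i, inj_res E d.+1 (M i)) ->
  exists N : fcomplex s A, (forall i, inj_res E d (N i)) /\
    forall Q : K, representable Q (fshift M) -> representable Q N.
Proof.
move=> /(@dependent_choice _ _)[T /(@dependent_choice _ _)[C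
  /(@dependent_choice _ _)[a /(@dependent_choice _ _)[c h]]]].
pose L := cofree s (fun j => D (T j)).
pose j i : nat_trans (M i) (L i) :=
  nt_pair (a i) (nt_comp (a (s i)) (fdiff M i)).
have jd i X u : fdiff L i X (j i X u) = j (s i) X (fdiff M i X u).
  by rewrite /= fdiffK linear0.
have aI i : nt_injective (a i) by case: (h i) => -[].
have ac i : nt_exact (a i) (c i) by case: (h i) => -[].
have cS i : nt_surjective (c i) by case: (h i) => -[].
(* The cokernel of [j] in degree [i] is [C i] plus the dual functor of
   [T (s i)], once [delta] has straightened the second component of [j]. *)
have /(@dependent_choice _ _)[delta hdelta] := fun i =>
  dual_functor_extend E_inj (nt_comp (a (s i)) (fdiff M i)) (aI i).
pose N i := prodF (C i) (D (T (s i))).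
pose p i : nat_trans (L i) (N i) :=
  nt_pair (nt_copair (c i) (nt_zero _ _)) (nt_copair (ntN (delta i)) (nt_id _)).
have pE i X (u : L i X) : p i X u = (c i X u.1, u.2 - delta i X u.1).
  by rewrite /= addr0 addrC.
have pS i : nt_surjective (p i).
  move=> X [x y]; have [v hv] := cS i X x.
  by exists (v, y + delta i X v); rewrite pE /= hv addrK.
have jp i : nt_exact (j i) (p i).
  move=> X u; rewrite pE; split=> [e|[v <-]].
    have /ac[v hv] : c i X u.1 = 0 by have := congr1 fst e.
    have {}e : u.2 - delta i X u.1 = 0 by have := congr1 snd e.
    exists v; case: u hv e => u1 u2 /= <- e; congr (_, _); apply/eqP.
    by rewrite eq_sym -subr_eq0 -[X in _ - X]hdelta e.
  have e0 : c i X (a i X v) = 0 by apply/ac; exists v.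
  by rewrite /= hdelta subrr e0.
have /(@dependent_choice _ _)[dN hdN] i : exists dN : nat_trans (N i) (N (s i)),
    forall X u, dN X (p i X u) = p (s i) X (fdiff L i X u).
  apply: (nt_descend (a := nt_comp (p (s i)) (fdiff L i))) => [|X u].
    exact: pS.
  move=> /jp[v <-]; apply/jp; exists (fdiff M i X v); exact/esym/jd.
have d2 i X u : dN (s i) X (dN i X u) = 0.
  have [v <-] := pS i X u.
  by rewrite !hdN fdiffK; exact: linear0.
exists (FComplex d2); split.
  by move=> i; apply: inj_res_prod; case: (h i).
move=> Q; apply: (representable_step (M := FComplex d2) s_inj (j := j) (p := p)
  (c := cofree_contraction s (fun j => D (T j)))) => //.
- move=> i; split; [|exact: jp|exact: pS].
  by move=> X u v e; apply: (aI i X); have := congr1 fst e.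
by move=> i X u; apply: cofree_contractible.
Qed.

Hypothesis E_cogen : minimal_injective_cogenerator E.
Hypothesis fin : hom_finite A.

(** In the base case full faithfulness of [D] turns the differential of [M] into
    one over [A]. *)
Theorem inj_representable d (M : fcomplex s A) :
  (forall i, inj_res E d (M i)) -> exists T : K,
    forall Q : K, representable Q M -> representable Q (dual_complex T).
Proof.
elim: d M => [|d IH] M; last first.
  have [M' ->] := funshift s_inj M => hM.
  have [|N [hN rN]] := @inj_step d M'; first exact: (all_succ s_inj).
  by have [T hT] := IH N hN; exists T => Q /rN/hT.
move=> /(@dependent_choice _ _)[T /(@dependent_choice _ _)[a ha]].
have aI i : nt_injective (a i) by case: (ha i).
have aS i : nt_surjective (a i) by case: (ha i).
have /(@dependent_choice _ _)[b hb] i : exists b : nat_trans (M i) (D (T i)),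
    forall X u, b X (a i X u) = u.
  have [b hb] := nt_descend (a := nt_id _) (aS i) (fun X u e =>
    aI i X u 0 (etrans e (esym (linear0 (a i X))))).
  by exists b.
have /(@dependent_choice _ _)[t ht] i : exists t : hom (T i) (T (s i)),
    forall X phi, b (s i) X (fdiff M i X (a i X phi)) = nt_dual E t X phi.
  exact: (nt_dual_full E_inj E_cogen fin
    (nt_comp (b (s i)) (nt_comp (fdiff M i) (a i)))).
have ab i X u : a i X (b i X u) = u.
  by have [v <-] := aS i X u; rewrite hb.
have t2 i : t (s i) ∘ t i = 0.
  apply: (nt_dual_faithful E_inj E_cogen fin) => W phi.
  by rewrite nt_dualM -!ht ab fdiffK linear0 nt_dual0.
have d2 i : - t (s i) ∘ - t i = 0 by rewrite compNl compNr opprK.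
pose Y : K := Complex d2.
exists Y => Q; apply: (representable_iso (N := dual_complex Y) (a := b)).
- move=> i X u; have [v <-] := aS i X u; rewrite hb ht.
  by rewrite [LHS](_ : _ = nt_dual E (- - t i) X v) // opprK.
- move=> i X u v; have [u' <-] := aS i X u; have [v' <-] := aS i X v.
  by rewrite !hb => ->.
by move=> i X u; exists (a i X u); rewrite hb.
Qed.

End InjectiveResolutions.

(** * Resolutions over a dualizing category of finite global dimension *)

Section Dimensions.
Variables (k : comPzRingType) (A : klincat k) (E : lmodType k).
Hypothesis idc : idempotent_complete A.
Implicit Types F G H C : modA A.
Local Notation D := (dual_hom_functor E).

Lemma finitely_presented_hom (X : A) : finitely_presented (hom_functor X).
Proof.
exists X, X, (nt_zero _ _), (nt_id _); split; last by move=> Y v; exists v.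
by move=> Y v; split=> [/= ->|[u <-] //]; exists 0.
Qed.

Lemma finitely_copresented_dual (X : A) : finitely_copresented E (D X).
Proof.
exists X, X, (nt_id _), (nt_zero _ _); split; first by move=> Y.
by move=> Y v; split=> [_|[u <-] //]; exists v.
Qed.

(** A projective object of mod A is a summand of a representable functor, and
    the idempotent of the summand splits in [A]. *)
Lemma mod_projective_representable (P : modA A) : mod_projective P ->
  exists R (a : nat_trans (hom_functor R) P), nt_injective a /\ nt_surjective a.
Proof.
move=> [fpP projP]; have [X [Y [a [b [_ bS]]]]] := fpP.
have [h hb] := projP _ _ b (nt_id P) (finitely_presented_hom Y) fpP bS.
have {}hb Z u : b Z (h Z u) = u by exact: hb.
pose e : hom Y Y := h Y (b Y (idm Y)).
have eE Z (f : hom Z Y) : e ∘ f = h Z (b Z f).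
  by rewrite (yonedaE b) nt_nat.
have ee : e ∘ e = e by rewrite eE /e hb.
have [R [i [p [pi ip]]]] := idc ee.
exists R, (nt_comp b (nt_post i)); split=> Z.
  move=> f g /= efg.
  have : p ∘ (e ∘ (i ∘ f)) = p ∘ (e ∘ (i ∘ g)) by rewrite !eE efg.
  by rewrite -ip !compA pi !comp1m pi !comp1m.
move=> v; exists (p ∘ h Z v).
by rewrite /= compA ip eE !hb.
Qed.

(** Replacing the first term by an isomorphic representable, the rest of the
    resolution resolves the kernel. *)
Lemma proj_res_of_pd d F : pd_le d F -> proj_res d F.
Proof.
move=> [P [del [eps [proj van epsS exe exd]]]].
elim: d F P del eps proj van epsS exe exd => [|d IH] F P del eps proj van epsS
  exe exd; have [R [a [aI aS]]] := mod_projective_representable (proj 0%N).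
  exists R, (nt_comp eps a); split=> X.
    move=> f g e; apply: (aI X); apply/eqP; rewrite -subr_eq0; apply/eqP.
    have /exe[u <-] : eps X (a X f - a X g) = 0.
      by rewrite linearB /=; apply/eqP; rewrite subr_eq0; apply/eqP.
    by rewrite (van 1%N isT X u) linear0.
  by move=> v; have [u <-] := epsS X v; have [f <-] := aS X u; exists f.
have [K [j [jI jp]]] := kernel_exists (nt_comp eps a).
have [b hb] := nt_descend (a := nt_id _) aS (fun X u e =>
  aI X u 0 (etrans e (esym (linear0 (a X))))).
have {}hb X f : b X (a X f) = f by exact: hb.
have ab X u : a X (b X u) = u by have [f <-] := aS X u; rewrite hb.
have [|eps' heps] := @nt_corestrict _ _ _ _ _ j (nt_comp b (del 0%N)) jI.
  by move=> X u; apply/jp; rewrite /= ab; apply/exe; exists u.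
exists R, K, j, (nt_comp eps a); split.
  split=> // X v; have [u <-] := epsS X v; have [f <-] := aS X u.
  by exists f.
apply: (IH K (fun i => P i.+1) (fun i => del i.+1) eps') => //.
- by move=> i di X u; apply: van.
- move=> X v; have /exe[u hu] : eps X (a X (j X v)) = 0 by apply/jp; exists v.
  by exists u; apply: (jI X); rewrite heps /= hu hb.
move=> X u; rewrite -(exd 0%N X u); split=> e.
  by rewrite -[del _ _ _]ab; have /= <- := heps X u; rewrite e !linear0.
apply: (jI X); have /= -> := heps X u; by rewrite e !linear0.
Qed.

Hypothesis E_inj : injective_module E.
Hypothesis add : additive_category A.
Hypothesis dual : dualizing A E.

(** Cokernels of finitely presented functors are finitely presented, so the
    process of embedding into the dual of a representable can be iterated. *)
Lemma cosyzygy_step F : finitely_presented F ->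
  exists (T : A) C (a : nat_trans F (D T)) (c : nat_trans (D T) C),
    short_exact a c /\ finitely_presented C.
Proof.
move=> fpF; have [T [T' [a [b [aI ab]]]]] := (dual F).1 fpF.
pose W X : set (D T' X) := range (b X).
have hW X : submodule (@W X).
  split; first by exists 0 => //; exact: linear0.
  move=> c _ _ [u _ <-] [v _ <-]; exists (c *: u + v) => //.
  exact: linearP.
have st (X Y : A) (f : hom X Y) u : W Y u -> W X (mmap (D T') f u).
  by move=> [v _ <-]; exists (mmap (D T) f v) => //; rewrite nt_nat.
have [|c hc] := nt_corestrict (a := b) (sub_incl_inj (hW := hW) (stable := st)).
  by move=> X u; apply: sub_incl_mem; exists u.
have cS : nt_surjective c.
  move=> X v; have [u _ hu] : W X (sub_incl hW st X v) by exact: sub_incl_val.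
  by exists u; apply: (sub_incl_inj (hW := hW) (stable := st)); rewrite hc.
have ac : nt_exact a c.
  move=> X v; rewrite -(ab X v); split=> e; first by rewrite -hc e linear0.
  by apply: (sub_incl_inj (hW := hW) (stable := st)); rewrite hc e;
    exact/esym/linear0.
exists T, (subF hW st), a, c; split=> //.
have [X0 [Y0 [_ [bF [_ bFS]]]]] := fpF.
have [X1 [X2 [g [h [gh hS]]]]] := (dual (D T)).2 (finitely_copresented_dual T).
have [y hy] := hS _ (a Y0 (bF Y0 (idm Y0))).
have [S [i1 [i2 [p1 [p2 [e1 e2 e3 e4 _]]]]]] := add.2 X1 Y0.
have hyE Z (w : hom Z Y0) : h Z (y ∘ w) = a Z (bF Z w).
  by rewrite (yonedaE bF) nt_nat -hy -nt_nat.
exists S, X2, (nt_post (g X1 (idm X1) ∘ p1 + y ∘ p2)), (nt_comp c h); split.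
  move=> Z v; split=> [/ac[u hu]|[f <-]].
    have [w hw] := bFS Z u.
    have /gh[z hz] : h Z (v - y ∘ w) = 0.
      by rewrite linearB /= hyE hw hu subrr.
    exists (i1 ∘ z + i2 ∘ w); rewrite /= compDl !compDr !compA.
    rewrite !(compKr e1, compKr e2, compKr e3, compKr e4) !cbi addr0 add0r.
    have -> : g X1 (idm X1) ∘ z = v - y ∘ w by rewrite -hz [RHS](yonedaE g z).
    by rewrite subrK.
  apply/ac; exists (bF Z (p2 ∘ f)).
  rewrite -hyE /= compDl linearD /= -!compA.
  have -> : h Z (g X1 (idm X1) ∘ (p1 ∘ f)) = 0.
    by apply/gh; exists (p1 ∘ f); exact: (yonedaE g).
  by rewrite add0r.
move=> Z v; have [u <-] := cS Z v; have [f <-] := hS Z u.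
by exists f.
Qed.

Fixpoint cosyzygy (d : nat) (C : modA A) : Prop :=
  if d is d'.+1 then
    exists (C' : modA A) (T : A) (a : nat_trans C' (D T))
      (c : nat_trans (D T) C), short_exact a c /\ cosyzygy d' C'
  else True.

(** The vanishing of Ext in degree [d + 1] against a [d]-th cosyzygy, by
    dimension shifting on both sides. *)
Lemma cosyzygy_lift d G : proj_res d G ->
  forall C C' (T : A) (a : nat_trans C (D T)) (c : nat_trans (D T) C'),
  short_exact a c -> cosyzygy d C -> forall b : nat_trans G C',
  exists b' : nat_trans G (D T), forall X u, c X (b' X u) = b X u.
Proof.
elim: d G => [|d IH] G.
  move=> [R [g [gI gS]]] C C' T a c [_ _ cS] _ b.
  have [x hx] := cS R (b R (g R (idm R))).
  have [|b' hb'] := nt_descend (a := nt_yoneda x) gS.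
    by move=> X f e; rewrite (gI X f 0) ?linear0.
  exists b' => X u; have [f <-] := gS X u.
  rewrite hb' [LHS](_ : _ = mmap C' f (c R x)); last exact: nt_nat.
  by rewrite hx (yonedaE g f) nt_nat.
move=> [R [N [kap [pi [[kI kp pS] hN]]]]] C C' T a c [aI ac cS].
move=> [C0 [T' [a' [c' [sa hC0]]]]] b.
have [x hx] := cS R (b R (pi R (idm R))).
pose h0 := nt_yoneda x.
have ch0 X f : c X (h0 X f) = b X (pi X f).
  rewrite [LHS](_ : _ = mmap C' f (c R x)); last exact: nt_nat.
  by rewrite hx (yonedaE pi f) nt_nat.
have pik X u : pi X (kap X u) = 0 by apply/kp; exists u.
have [|n hn] := @nt_corestrict _ _ _ _ _ a (nt_comp h0 kap) aI.
  by move=> X u; apply/ac; rewrite [LHS]ch0 pik linear0.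
(* [h0] lifts [b] on generators; its restriction to the syzygy [N] factors
   through [C] as [n], and extending a lift of [n] gives the correction that
   makes [h0] vanish on [N]. *)
have [n' hn'] := IH N hN _ _ _ _ _ sa hC0 n.
have [n2 hn2] := dual_functor_extend E_inj n' kI.
pose h1 := nt_comp a (nt_comp c' n2).
have [|b' hb'] := nt_descend (a := ntD h0 (ntN h1)) pS.
  move=> X f /kp[u <-]; rewrite [LHS](_ : _ = h0 X (kap X u) -
    a X (c' X (n2 X (kap X u)))) // hn2 hn' hn.
  exact: subrr.
exists b' => X u; have [f <-] := pS X u; rewrite hb'.
rewrite [LHS](_ : _ = c X (h0 X f - a X (c' X (n2 X f)))) // linearB ch0 /=.
have -> : c X (a X (c' X (n2 X f))) = 0 by apply/ac; exists (c' X (n2 X f)).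
by rewrite subr0.
Qed.

Hypothesis E_cogen : minimal_injective_cogenerator E.
Hypothesis fin : hom_finite A.

(** By full faithfulness the idempotent [sg ∘ c] of [D T] comes from one of [T],
    which splits in [A]. *)
Lemma inj_res_retract C (T : A) (c : nat_trans (D T) C)
    (sg : nat_trans C (D T)) :
  (forall X u, c X (sg X u) = u) -> inj_res E 0 C.
Proof.
move=> csg.
have [g hg] := nt_dual_full E_inj E_cogen fin (nt_comp sg c).
have {}hg W phi : sg W (c W phi) = nt_dual E g W phi by exact: hg.
have gg : g ∘ g = g.
  apply: (nt_dual_faithful E_inj E_cogen fin) => W phi.
  by rewrite nt_dualM -!hg csg.
have [R [i [p [pi ip]]]] := idc gg.
exists R, (nt_comp c (nt_dual E i)); split=> W.
  move=> phi psi e.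
  have {e} : nt_dual E p W (sg W (c W (nt_dual E i W phi))) =
      nt_dual E p W (sg W (c W (nt_dual E i W psi))).
    by congr (nt_dual E p W (sg W _)).
  by rewrite !hg -!nt_dualM -ip !compA pi !comp1m pi !nt_dual1.
move=> v; exists (nt_dual E p W (sg W v)).
rewrite [LHS](_ : _ = c W (nt_dual E i W (nt_dual E p W (sg W v)))) //.
by rewrite -nt_dualM ip -hg !csg.
Qed.

Hypothesis gldim : finite_global_dimension A.

Lemma dual_proj_res : exists d, forall X : A, proj_res d (D X).
Proof.
have [d hd] := gldim; exists d => X; apply: proj_res_of_pd; apply: hd.
by apply/(dual _).2/finitely_copresented_dual.
Qed.

(** Finite global dimension bounds injective dimensions as well: a cosyzygy of
    high order is a direct summand of the dual functor that covers it. *)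
Lemma hom_inj_res : exists d, forall X : A, inj_res E d (hom_functor X).
Proof.
have [d hd] := gldim; exists d.+1 => X.
suff main r j C : (j + r = d.+1)%N -> finitely_presented C -> cosyzygy j C ->
    inj_res E r C.
  by apply: (main _ 0%N) => //; apply: finitely_presented_hom.
elim: r j C => [|r IH] j C.
  rewrite addn0 => -> fpC [C' [T [a [c [ac hC']]]]].
  have [sg hsg] :=
    cosyzygy_lift (proj_res_of_pd (hd _ fpC)) ac hC' (nt_id C).
  exact: inj_res_retract hsg.
rewrite addnS -addSn => e fpC hC.
have [T [C' [a [c [ac fpC']]]]] := cosyzygy_step fpC.
exists T, C', a, c; split=> //; apply: (IH j.+1) => //.
by exists C, T, a, c.
Qed.

End Dimensions.

(** * The trace pairing and almost split sequences *)

Lemma single_family (I : eqType) (V : I -> zmodType) (i0 : I) (x : V i0) :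
  exists h : forall i, V i, h i0 = x /\ forall i, i != i0 -> h i = 0.
Proof.
have /(@dependent_choice _ V)[h hh] : forall i, exists y : V i,
    (forall e : i0 = i, y = eq_rect i0 V x i e) /\ (i != i0 -> y = 0).
  move=> i; have [->|ne] := eqVneq i i0.
    by exists x; split=> [e|]; rewrite ?eqxx // eq_axiomK.
  by exists 0; split=> // e; rewrite e eqxx in ne.
exists h; split=> [|i]; last by case: (hh i).
by have [-> //] := hh i0.
Qed.

Section Boundaries.
Variables (I : finType) (s : I -> I) (k : comPzRingType) (A : klincat k).
Local Notation K := (complex_cat s A).
Variable M : fcomplex s A.

Lemma boundaryB (Y : K) (u v : forall i, M i (cobj Y i)) :
  boundary u -> boundary v -> boundary (fun i => u i - v i).
Proof.
move=> [g hg] [h hh]; exists (fun i => g i - h i) => i.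
by rewrite hg hh !linearB /= opprD addrACA.
Qed.

Lemma boundary_pull (Y W : K) (u : forall i, M i (cobj Y i)) (f : hom W Y) :
  boundary u -> boundary (pull u f).
Proof.
move=> [h hh]; exists (fun i => mmap (M i) (f (s i)) (h i)) => i.
by rewrite /pull hh linearD /= -!nt_nat -!mmapM (chain_comm f).
Qed.

Lemma null_pull (Y W : K) (u : forall i, M i (cobj Y i)) (f : hom W Y) :
  cocycle u -> null f -> boundary (pull u f).
Proof.
move=> cu [h hf]; exists (fun i => mmap (M i) (h i) (u i)) => i.
by rewrite /pull hf mmapD !mmapM -cu nt_nat.
Qed.

End Boundaries.

Section Trace.
Variables (m : nat) (s : 'I_m -> 'I_m) (k : comPzRingType) (A : klincat k).
Variable E : lmodType k.
Hypothesis s_inj : injective s.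
Hypothesis add : additive_category A.
Hypothesis E_inj : injective_module E.
Local Notation K := (complex_cat s A).
Implicit Types X Y T W R : K.

Definition trace T Y (u : forall i, {linear hom (cobj T i) (cobj Y i) -> E})
  (f : forall i, hom (cobj T i) (cobj Y i)) : E := \sum_i u i (f i).

(** Summation over all degrees moves the second half of the homotopy to the same
    index as the first. *)
Lemma trace_htpy T Y (u : forall i, dual_complex E T i (cobj Y i))
    (h : forall i, hom (cobj T (s i)) (cobj Y i)) (f : hom T Y) :
  (forall i, f (s i) = cdiff Y i ∘ h i + h (s i) ∘ cdiff T (s i)) ->
  trace u f = \sum_i ((u (s i) : {linear hom _ _ -> E}) (cdiff Y i ∘ h i) +
    (u i : {linear hom _ _ -> E}) (h i ∘ cdiff T i)).
Proof.
move=> hf; rewrite /trace (reindex_inj s_inj) big_split /=.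
rewrite [X in _ + X](reindex_inj s_inj) -big_split /=.
by apply: eq_bigr => i _; rewrite hf linearD.
Qed.

Lemma trace_null T Y (u : forall i, dual_complex E T i (cobj Y i)) f :
  cocycle u -> null f -> trace u f = 0.
Proof.
move=> cu [h hf]; rewrite (trace_htpy _ hf) big1 // => i _.
have := congr1 (fun q : {linear hom _ _ -> E} => q (h i)) (cu i).
by rewrite /= compNr linearN => <-; rewrite addNr.
Qed.

Lemma trace_boundary T Y (u : forall i, dual_complex E T i (cobj Y i))
    (f : hom T Y) : boundary u -> trace u f = 0.
Proof.
move=> [h hu]; rewrite /trace (reindex_inj s_inj) /=.
under eq_bigr => i _ do rewrite hu /=.
rewrite big_split /= [X in _ + X](_ : _ = \sum_i
  (h i : {linear hom _ _ -> E}) (cdiff Y i ∘ f i)); last first.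
  by rewrite [RHS](reindex_inj s_inj).
rewrite -big_split big1 //= => i _.
by rewrite compNr linearN (chain_comm f) addNr.
Qed.

(** Injectivity of [E] extends the functional to graded maps, that is, to maps
    between the total objects, where it is a sum of functionals in the single
    degrees; it kills the null-homotopic maps exactly if these form a cocycle. *)
Lemma trace_surjective T Y (phi : {linear hom T Y -> E}) :
  (forall f, null f -> phi f = 0) ->
  exists u : forall i, dual_complex E T i (cobj Y i),
    cocycle u /\ forall f : hom T Y, phi f = trace u f.
Proof.
move=> hphi.
have [S [e [p [pe pe0 _]]]] := direct_sum_exists add (cobj T).
have [S' [e' [p' [pe' pe0' _]]]] := direct_sum_exists add (cobj Y).
have lin : linear (fun f : hom T Y => total p e' (fun i => f i)).
  by move=> c f g; rewrite -total_linear.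
have [|Phi hPhi] := extend_along E_inj (a := mklin lin) (phi := phi).
  move=> f /= f0; suff -> : f = 0 by rewrite linear0.
  apply: chain_ext => j.
  rewrite -(total_component (e := e) (p := p) f j pe pe0 pe' pe0') f0.
  by rewrite comp0D compD0.
have ulin i : linear (fun g : hom (cobj T i) (cobj Y i) => Phi (e' i ∘ g ∘ p i)).
  by move=> c f g; rewrite -linearP compDr compDl compZr compZl.
pose u i : dual_complex E T i (cobj Y i) := mklin (ulin i).
have tr (f : hom T Y) : phi f = trace u f.
  by rewrite -hPhi /= /total linear_sum.
exists u; split=> // i; apply: lin_ext => g.
rewrite [LHS](_ : _ = Phi (e' i ∘ (g ∘ - cdiff T i) ∘ p i)) //.
rewrite [RHS](_ : _ = Phi (e' (s i) ∘ (cdiff Y i ∘ g) ∘ p (s i))) //.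
have [h [h0 h1]] := single_family
  (V := fun i => hom (cobj T (s i)) (cobj Y i)) g.
have [f hf] := htpy_map s_inj h.
have := hphi f (ex_intro _ h hf).
rewrite tr (trace_htpy u hf) (bigD1 i) //= big1 => [|j ji]; last first.
  by rewrite h1 // !cbi !linear0 addr0.
rewrite h0 addr0 => /eqP; rewrite addr_eq0 => /eqP ->.
by rewrite compNr compNr compNl linearN.
Qed.

(** The chain maps are the kernel of the coboundary on graded maps, so the trace
    factors through it; extended by the injectivity of [E], the factor is the
    homotopy. *)
Lemma trace_injective T Y (u : forall i, dual_complex E T i (cobj Y i)) :
  (forall f : hom T Y, trace u f = 0) -> boundary u.
Proof.
move=> hu.
have [S [e [p [pe pe0 _]]]] := direct_sum_exists add (cobj T).
have [S' [e' [p' [pe' pe0' _]]]] := direct_sum_exists add (cobj Y).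
have [S2 [e2 [p2 [pe2 pe02 _]]]] := direct_sum_exists add (fun i => cobj Y (s i)).
pose cmp (F : hom S S') i : hom (cobj T i) (cobj Y i) := p' i ∘ F ∘ e i.
have cmpP c F G i : cmp (c *: F + G) i = c *: cmp F i + cmp G i.
  by rewrite /cmp compDr compDl compZr compZl.
pose cob (F : hom S S') i := cdiff Y i ∘ cmp F i - cmp F (s i) ∘ cdiff T i.
have al : linear (fun F => total p e2 (cob F)).
  move=> c F G; rewrite -total_linear; congr total.
  apply: functional_extensionality_dep => i.
  rewrite /cob !cmpP compDr compDl compZr compZl scalerBr opprD addrACA.
  by [].
have ph : linear (fun F => trace u (cmp F)).
  move=> c F G; rewrite /trace scaler_sumr -big_split; apply: eq_bigr => i _.
  by rewrite cmpP linearP.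
have [|psi hpsi] := extend_along E_inj (a := mklin al) (phi := mklin ph).
  move=> F /= F0.
  have fc i : cdiff Y i ∘ cmp F i = cmp F (s i) ∘ cdiff T i.
    apply/eqP; rewrite -subr_eq0 -/(cob F i); apply/eqP.
    rewrite -(total_component (e := e) (p := p) (cob F) i pe pe0 pe2 pe02) F0.
    by rewrite comp0D compD0.
  exact: (hu (ChainMap fc)).
have vlin i : linear (fun g : hom (cobj T i) (cobj Y (s i)) =>
    psi (e2 i ∘ g ∘ p i)).
  by move=> c f g; rewrite -linearP compDr compDl compZr compZl.
exists (fun i => mklin (vlin i)) => i; apply: lin_ext => x.
have [f [f0 f1]] := single_family (V := fun i => hom (cobj T i) (cobj Y i)) x.
have := hpsi (total p e' f); rewrite /=.
have -> : cmp (total p e' f) = f.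
  by apply: functional_extensionality_dep => j; apply: total_component.
have cmpf : cmp (total p e' f) = f.
  by apply: functional_extensionality_dep => j; apply: total_component.
rewrite /trace (bigD1 (s i)) //= big1 ?addr0 => [|j ji]; last first.
  by rewrite f1 // linear0.
rewrite f0 => <-; rewrite /total linear_sum /=.
under eq_bigr => j _ do rewrite /cob cmpf compBr compBl linearB.
rewrite big_split /= addrC; congr (_ + _).
  rewrite (bigD1 i) //= big1 ?addr0 => [|j ji].
    by rewrite f0 compNr compNr compNl linearN.
  by rewrite f1 ?(inj_eq s_inj) // !cbi linear0 oppr0.
rewrite (bigD1 (s i)) //= big1 ?addr0 => [|j ji]; first by rewrite f0.
by rewrite f1 // !cbi linear0.
Qed.

End Trace.

Section AlmostSplit.
Variables (m : nat) (s : 'I_m -> 'I_m) (k : comPzRingType) (A : klincat k).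
Variable E : lmodType k.
Hypothesis s_inj : injective s.
Hypothesis ks : krull_schmidt A.
Hypothesis fin : hom_finite A.
Hypothesis E_cogen : minimal_injective_cogenerator E.
Local Notation K := (complex_cat s A).
Implicit Types X Y Z T W R : K.

Let E_inj : injective_module E := E_cogen.1.
Let add : additive_category A := ks.1.

Let complex_idc : idempotent_complete K.
Proof.
exact/complex_idempotent_complete/krull_schmidt_idempotent_complete.
Qed.

Let complex_rk X Y : ranked (hom X Y).
Proof. exact: complex_ranked. Qed.

Lemma nonisos_submodule R : local_end R ->
  submodule [set f : hom R R | ~ is_iso f].
Proof.
move=> [ne loc]; split.
  by move=> [g []]; rewrite comp0D => e _; apply: ne.
move=> c f g nf ng /loc[[h [h1 h2]]|//]; apply: nf.
by exists (c *: h); rewrite compZl -compZr h1 compZr -compZl h2.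
Qed.

Lemma local_factor_split R W (h : hom W R) (f : hom R W) : is_iso (h ∘ f) ->
  split_epi h.
Proof. by move=> [g [_ e]]; exists (f ∘ g); rewrite compA. Qed.

(** Serre duality produces the class of the almost split sequence: a functional
    on End R that kills exactly the radical corresponds to a map from [R] that
    does not vanish but is killed by every non-split epimorphism to [R]. *)
Lemma almost_vanishing_map X T R (i : hom R T) (p : hom T R) :
  representable (shift X) (dual_complex E T) -> p ∘ i = idm R ->
  local_end R -> ~ null (idm R) ->
  exists xi : hom R (shift X : K), ~ null xi /\
    forall W (h : hom W R), ~ split_epi h -> null (xi ∘ h).
Proof.
move=> [U [cU U1 U2]] pi loc nn.
have id_iso : ~ [set f : hom R R | ~ is_iso f] (idm R).
  by apply; exists (idm R); rewrite comp1m.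
have [phi0 [phi00 phi01]] := cogenerate E_inj E_cogen (complex_rk R R)
  (nonisos_submodule loc) id_iso.
have lin : linear (fun g : hom T R => phi0 (g ∘ i)).
  by move=> c f g; rewrite compDl compZl linearP.
have [|u [cu hu]] := trace_surjective s_inj add E_inj (phi := mklin lin).
  move=> f nf; apply: phi00 => -[g [gf _]]; apply: nn.
  by rewrite -gf; apply/null_compl/null_compr.
have [xi bxi] := U1 _ _ cu; exists xi; split.
  move=> nxi; apply: phi01; rewrite -pi.
  have /= -> := hu p; apply: trace_boundary => //.
  have [h hh] := bxi; have [g hg] := null_pull cU nxi.
  exists (fun j => h j + g j) => j.
  by rewrite -[u (s j)](subrK (pull U xi (s j))) hh hg !linearD /= addrACA.
move=> W h nse; apply: U2.
have b1 : boundary (pull u h).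
  apply: (trace_injective s_inj add E_inj) => f.
  have : trace u (fun j => h j ∘ f j) = phi0 (h ∘ f ∘ i).
    by have /= := hu (h ∘ f); rewrite /= => ->.
  rewrite phi00 // -compA => iso; exact/nse/(local_factor_split iso).
have [g hg] := boundaryB b1 (boundary_pull h bxi); exists g => j.
rewrite -hg /pull linearB subKr; exact: mmapM.
Qed.

(** Here [T = Z], and [X] is a local summand, on which the class does not vanish,
    of the complex that represents the dual of the maps out of [Z]. *)
Lemma almost_split_end d Z : (forall X : A, proj_res d (dual_hom_functor E X)) ->
  indecomposable Z -> ~ exact_projective (@degreewise_split _ s k A) Z ->
  exists X Y (f : hom X Y) (g : hom Y Z),
    almost_split_sequence (@degreewise_split _ s k A) f g.
Proof.
move=> hd ind np.
have loc := indecomposable_local complex_idc (fun X => complex_rk X X) ind.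
have nZ : ~ null (idm Z) by move=> /(contractible_projective s_inj).
have [Q0 hQ] := proj_representable add s_inj
  (M := dual_complex E Z) (fun i => hd (cobj Z i)).
have [X eX] := unshift s_inj Q0; subst Q0.
have [xi [nxi kxi]] := almost_vanishing_map hQ (comp1m (idm Z)) loc nZ.
have [||e g|R [i [p [locR pi nip]]]] := local_summand complex_idc
  (fun X => complex_rk X X) (P := fun e : hom X X => ~ null (shift_map e ∘ xi)).
- by rewrite shift_map1 comp1m.
- apply; have -> : shift_map (0 : hom X X) = 0 by exact: chain_ext.
  by rewrite compD0; exact: (null_submodule _ _).1.
- move=> ne; apply: contrapT => /not_orP[/contrapT h1 /contrapT h2].
  apply: ne; rewrite shift_mapD compDl.
  exact: (submD (null_submodule _ _)).
have [||Y [f [g fg]]] := almost_split_extension s_inj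
  (xi := shift_map p ∘ xi) add locR loc; last by exists R, Y, f, g.
  move=> n; apply: nip; rewrite shift_mapM -compA; exact: null_compl.
move=> W h nse; rewrite -compA; apply: null_compl; exact: kxi.
Qed.

(** Here [X] is given, and [Z] is a noncontractible local summand of the complex
    [T] for which the maps into the shift of [X] are dual to the maps out of
    [T]. *)
Lemma almost_split_start d X : (forall X : A, inj_res E d (hom_functor X)) ->
  indecomposable X -> ~ exact_injective (@degreewise_split _ s k A) X ->
  exists Y Z (f : hom X Y) (g : hom Y Z),
    almost_split_sequence (@degreewise_split _ s k A) f g.
Proof.
move=> hd ind ni.
have loc := indecomposable_local complex_idc (fun X => complex_rk X X) ind.
have nX : ~ null (idm X) by move=> /(contractible_injective s_inj).
have [T hT] := inj_representable E_inj add s_inj E_cogen fin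
  (M := hom_complex (shift X : K)) (fun i => hd (cobj (shift X) i)).
have {}hT := hT _ (representable_hom _).
have nT : ~ null (idm T).
  move=> nT; apply: nX; apply: (contractible_shift s_inj).
  have [U [cU _ U2]] := hT; apply: U2; apply: boundary_pull.
  apply: (trace_injective s_inj add E_inj) => f; apply: (trace_null s_inj) => //.
  by rewrite -[f]compm1; apply: null_compl.
have [||e g|R [i [p [locR pi nip]]]] := local_summand complex_idc
  (fun X => complex_rk X X) (P := fun e : hom T T => ~ null e).
- exact: nT.
- by apply; exact: (null_submodule _ _).1.
- move=> ne; apply: contrapT => /not_orP[/contrapT h1 /contrapT h2].
  by apply: ne; exact: (submD (null_submodule _ _)).
have nR : ~ null (idm R).
  move=> n; apply: nip; rewrite -[i]compm1 -compA.
  exact/null_compl/null_compr.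
have [xi [nxi kxi]] := almost_vanishing_map hT pi locR nR.
have [Y [f [g fg]]] := almost_split_extension s_inj add loc locR nxi kxi.
by exists Y, R, f, g.
Qed.

End AlmostSplit.

Theorem theorem3p6 (k : comPzRingType) (A : klincat k)
  (hom_fin : hom_finite A) (ks : krull_schmidt A)
  (n : nat) (n_ge2 : (2 <= n)%N)
  (shifts : forall X : bounded_cat A, indecomposable X ->
    exists2 Y : interval_cat A n, indecomposable Y
      & is_shift_of (sval X) (sval Y))
  (E : lmodType k) (E_cogen : minimal_injective_cogenerator E)
  (dual : dualizing A E) (gldim : finite_global_dimension A)
  (m : nat) (m_gt0 : (0 < m)%N) :
  has_almost_split_sequences (@periodic_conflation k A m).
Proof.
have idc := krull_schmidt_idempotent_complete ks.
split=> [Z ind np|X ind ni].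
  have [d hd] := dual_proj_res idc dual gldim.
  exact: (almost_split_end (@ordS_inj m) ks hom_fin E_cogen hd).
have [d hd] := hom_inj_res idc E_cogen.1 ks.1 dual E_cogen hom_fin gldim.
exact: (almost_split_start (@ordS_inj m) ks hom_fin E_cogen hd).
Qed.
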